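(* Let $(X_j)_{j\in\mathbb N}$ be the generic waiting-time sequence of a Crump-Mode-Jagers process $(\mathscr T_t)_{t\ge 0}$ as described in the context, let $(X'_j)_{j\in\mathbb N}$ be an independent copy of $(X_j)_{j\in\mathbb N}$, and assume Assumption (A) holds. Then, for the sequence of directed trees $(\mathscr T_{\tau_n})_{n\in\mathbb N_0}$: \begin{enumerate} \item If the series $\sum_{i=1}^\infty (X_i-X'_i)$ diverges almost surely, then almost surely $(\mathscr T_{\tau_n})_{n\in\mathbb N_0}$ does not contain a persistent hub. \item Suppose that for some $\alpha>0$ and $K\in\mathbb N$, \[\sum_{j=1}^\infty \mathbb E\Big[e^{-\alpha\sum_{i=1}^j X_i}\Big]<1 \quad\text{and}\quad \prod_{i=K+1}^\infty \mathbb E\Big[e^{\alpha(X'_i-X_i)}\Big]<\infty.\] Then almost surely $(\mathscr T_{\tau_n})_{n\in\mathbb N_0}$ contains a persistent hub. \end{enumerate}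
   Context: Ulam–Harris tree: $\mathcal U=\bigcup_{n\ge0}\mathbb N^n$ with $\mathbb N^0=\{\varnothing\}$ (the root); an element $u=(u_1,\dots,u_k)\in\mathbb N^k$ is written $u=u_1\cdots u_k$, $|u|=k$, and $uj$ denotes the $j$-th child of $u$. Let $(X_j)_{j\in\mathbb N}$ be a sequence of $[0,\infty]$-valued random variables and, for each $u\in\mathcal U$, let $(X(uj))_{j\in\mathbb N}$ be a copy of $(X_j)_{j\in\mathbb N}$, these sequences being independent over different $u$. Birth times are defined recursively by $\mathcal B(\varnothing)=0$ and $\mathcal B(ui)=\mathcal B(u)+\sum_{j=1}^i X(uj)$. For $t\in[0,\infty]$ set $\mathscr T_t=\{x\in\mathcal U:\mathcal B(x)\le t\}$, viewed as a directed tree with edges directed from each individual to its children, and set $\tau_k=\inf\{t\ge0:|\mathscr T_t|\ge k\}$. For a directed tree $T$, $\deg^+(u,T)$ is the out-degree of $u$ in $T$, with the convention $\deg^+(u,T)=-\infty$ if $u\notin T$. For a sequence of directed trees $(\mathcal T_n)_{n\in\mathbb N_0}$, a node $u\in\bigcup_n\mathcal T_n$ is a persistent hub if $\deg^+(u,\mathcal T_n)=\max_{v\in\mathcal T_n}\deg^+(v,\mathcal T_n)$ for all but finitely many $n$; the sequence contains a persistent hub if such a $u$ exists. Assumption (A): (i) the random variables $(X_i)_{i\in\mathbb N}$ are mutually independent; (ii) for each $j$, $X_j<\infty$ almost surely; (iii) $\sum_{j=1}^\infty\prod_{i=1}^j\mathbb P(X_i=0)<1$. *)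

(* Defs.v *)
From HB Require Import structures.
From mathcomp Require Import all_boot all_order all_algebra.
From mathcomp Require Import all_classical all_reals all_analysis.
From mathcomp Require Import measurable_realfun.
Set Implicit Arguments. Unset Strict Implicit. Unset Printing Implicit Defensive.
Import Order.TTheory GRing.Theory Num.Theory numFieldNormedType.Exports.
Local Open Scope classical_set_scope.
Local Open Scope ring_scope.
Local Open Scope ereal_scope.

(* Ulam-Harris tree: nodes are [seq nat]; [rcons u j] is the (j+1)-th child
   of u (children are indexed from 0 here, from 1 in the paper).           *)

Section CMJ.
Context {R : realType}.

(* Given the waiting times [X u j] (= X(u(j+1)) in the paper), birth time:
   B(empty) = 0 and B(u i) = B(u) + sum_{j<=i} X(uj).                      *)
Fixpoint birth_aux (X : seq nat -> nat -> \bar R) (p u : seq nat) : \bar R :=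
  match u with
  | [::] => 0
  | i :: u' => (\sum_(j < i.+1) X p j) + birth_aux X (rcons p i) u'
  end.

Definition birth (X : seq nat -> nat -> \bar R) (u : seq nat) : \bar R :=
  birth_aux X [::] u.

Definition cmj_tree (X : seq nat -> nat -> \bar R) (t : \bar R) : set (seq nat) :=
  [set x | birth X x <= t].

Definition cmj_tau (X : seq nat -> nat -> \bar R) (k : nat) : \bar R :=
  ereal_inf [set t : \bar R | 0 <= t /\ (k%:R)%:E <= @counting _ R (cmj_tree X t)].

Definition cmj_seq (X : seq nat -> nat -> \bar R) (n : nat) : set (seq nat) :=
  cmj_tree X (cmj_tau X n).

Definition outdeg (T : set (seq nat)) (u : seq nat) : \bar R :=
  if `[< T u >] then @counting _ R [set j : nat | T (rcons u j)] else -oo.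

Definition max_outdeg (T : set (seq nat)) : \bar R :=
  ereal_sup [set outdeg T v | v in T].

Definition persistent_hub (Tn : nat -> set (seq nat)) (u : seq nat) : Prop :=
  (exists n, Tn n u) /\
  exists N, forall n, (N <= n)%N -> outdeg (Tn n) u = max_outdeg (Tn n).

Definition has_persistent_hub (Tn : nat -> set (seq nat)) : Prop :=
  exists u, persistent_hub Tn u.

End CMJ.

Section Prob.
Context {R : realType} {d : measure_display} {Omega : measurableType d}.
Variable P : probability Omega R.

Definition same_law (Y Z : nat -> Omega -> \bar R) : Prop :=
  forall (n : nat) (B : nat -> set (\bar R)), (forall j, measurable (B j)) ->
    P (\bigcap_(j in [set j | (j < n)%N]) (Y j @^-1` B j))
    = P (\bigcap_(j in [set j | (j < n)%N]) (Z j @^-1` B j)).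

Definition mutual_indep (Y : nat -> Omega -> \bar R) : Prop :=
  forall (s : seq nat), uniq s -> forall B : nat -> set (\bar R),
    (forall i, measurable (B i)) ->
    P (\bigcap_(i in [set i | i \in s]) (Y i @^-1` B i))
    = \prod_(i <- s) P (Y i @^-1` B i).

(* mutual independence of a family, indexed by I, of random sequences:
   product rule on all finite-dimensional cylinder events of every finite
   subfamily (these form pi-systems generating the sigma-algebras) *)
Definition indep_seqs (I : eqType) (Y : I -> nat -> Omega -> \bar R) : Prop :=
  forall (s : seq I), uniq s -> forall (n : nat) (B : I -> nat -> set (\bar R)),
    (forall i j, measurable (B i j)) ->
    P (\bigcap_(i in [set i | i \in s])
         \bigcap_(j in [set j | (j < n)%N]) (Y i j @^-1` B i j))
    = \prod_(i <- s) P (\bigcap_(j in [set j | (j < n)%N]) (Y i j @^-1` B i j)).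

End Prob.

(* Main.v *)
(* The waiting times form a random configuration [x (u, j)] with independent coordinates,
   where the law of [x (u, j)] depends on [j] only.  For two nodes [u <> v] the walk
   [T n = \sum_(j < n) (x (u, j) - x (v, j))] compares the times at which [u] and [v] reach
   degree [n]; exchanging [x (u, j)] and [x (v, j)] for [j] in any set of indices flips the
   signs of those increments and preserves the law.  This symmetry gives, almost surely:
   (a) if [T] is bounded above then it converges;
   (b) if [T] converges then it does not cross a given level infinitely often;
   (c) Levy's maximal inequality.

   Absence of a hub: if [u] is a hub, then either all degrees stay bounded by some [m], which
   is impossible because the tree of the first [m] children is subcritical over short times
   and hence locally finite, or [T] is bounded above and converges by (a).

   Existence of a hub: the expected sum over all nodes [u] of [exp (- a * birth u)] is finite,
   so the tree is locally finite, and by (c) and Borel-Cantelli only finitely many nodes ever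
   have a larger degree than the root.  Among these finitely many nodes any two are eventually
   ordered by (b). *)
Require Import Defs.
From HB Require Import structures.
From mathcomp Require Import all_boot all_order all_algebra.
From mathcomp Require Import all_classical all_reals all_analysis.
From mathcomp Require Import measurable_realfun lra ring zify.
From mathcomp Require finmap.
Import Order.TTheory GRing.Theory Num.Theory numFieldNormedType.Exports.
Set Implicit Arguments. Unset Strict Implicit. Unset Printing Implicit Defensive.
Local Open Scope classical_set_scope.
Local Open Scope ring_scope.
Local Open Scope ereal_scope.

(** * Product laws on configuration spaces *)

Section ConfigurationSpace.
Context {R : realType} {I : choiceType}.

(** The hypotheses fix laws and independence but provide no map of [Omega] that exchanges waiting
    times. Everything is therefore moved to the product law on real configurations, where exchanging
    coordinates is an actual measure-preserving map; since the waiting times are almost surely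
    finite, passing to reals changes only a null set. Nothing is assumed about moments of the
    increments, so variance arguments do not apply directly. They are applied to gated walks, where
    a gate may look at the modulus of an increment but not at its sign: by sign symmetry the cross
    terms vanish whatever the tails are. In the existence part the condition on the product enters
    only through bounds on the expectation of [exp (a * (T N - T k))] that are uniform in [N], for
    [K <= k]. These bounds make [T] bounded above, hence convergent by (a), which is what (b)
    requires; they also give the summable overtaking probabilities. The first [K] columns may have
    infinite exponential moments, so they never receive a positive exponent: they are either
    absorbed in a starting value or cut off at a level [c]. *)

Definition box (s : seq I) (B : I -> set R) : set (I -> R) :=
  [set x | forall i, i \in s -> B i (x i)].

Definition boxes : set (set (I -> R)) :=
  [set A | exists s B, (forall i, measurable (B i)) /\ A = box s B].

Definition config := g_sigma_algebraType boxes.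

Lemma boxes_setI : setI_closed boxes.
Proof.
move=> _ _ [s [B [mB ->]]] [s' [B' [mB' ->]]].
pose C i := (if i \in s then B i else setT) `&` (if i \in s' then B' i else setT).
exists (s ++ s'), C; split.
  by move=> i; apply: measurableI; case: ifP.
apply/seteqP; split=> x.
  by move=> [h h'] i _; split; case: ifPn => // ?; [exact: h|exact: h'].
move=> h; split=> i si.
  by have [] := h i; rewrite ?mem_cat ?si.
by have [] := h i; rewrite ?mem_cat ?si ?orbT.
Qed.

Lemma measurable_box (s : seq I) (B : I -> set R) :
  (forall i, measurable (B i)) -> measurable (box s B : set config).
Proof. by move=> mB; apply: sub_sigma_algebra; exists s, B. Qed.

Lemma measurable_coord (i : I) : measurable_fun setT (fun x : config => x i).
Proof.
move=> _ A mA; rewrite setTI.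
have -> : (fun x : config => x i) @^-1` A = box [:: i] (fun=> A).
  apply/seteqP; split=> x /= h; last by apply: h; rewrite inE.
  by move=> j; rewrite inE => /eqP ->.
exact: measurable_box.
Qed.

Lemma measurable_to_config d (T : measurableType d) (f : T -> config) :
  (forall i, measurable_fun setT (fun t => f t i)) -> measurable_fun setT f.
Proof.
move=> mf; apply: (@measurability _ _ T config setT f boxes) => //.
move=> _ [_ [s [B [mB ->]]]] <-; rewrite setTI.
rewrite (_ : f @^-1` _ = \big[setI/setT]_(i <- s) ((fun t => f t i) @^-1` B i)).
  apply: bigsetI_measurable => i _; rewrite -[X in measurable X]setTI.
  exact: mf.
apply/seteqP; split=> t /=.
  rewrite /box/= => h; elim: s h => [|i s IH] h; first by rewrite big_nil.
  rewrite big_cons; split; first by apply: h; rewrite inE eqxx.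
  by apply: IH => j js; apply: h; rewrite inE js orbT.
elim: s => [_ ?//|i s IH]; rewrite big_cons => -[hi hs] j.
by rewrite inE => /orP[/eqP->//|]; exact: IH.
Qed.

End ConfigurationSpace.
Arguments config R I : clear implicits.

Section ProductLaw.
Context {R : realType}.

(** The labelling [k] is kept apart from the index so that several coordinates can share a law:
    [snd] labels both the tree coordinates [(u, j)] and the two generic sequences indexed by
    [bool]. *)
Definition product_law (I : choiceType) (k : I -> nat) (nu : nat -> probability R R)
    (mu : set (config R I) -> \bar R) :=
  forall (s : seq I) (B : I -> set R), uniq s -> (forall i, measurable (B i)) ->
    mu (box s B) = \prod_(i <- s) nu (k i) (B i).

Lemma box_undup (I : choiceType) (s : seq I) (B : I -> set R) :
  box s B = box (undup s) B.
Proof.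
by apply/seteqP; split=> x h i is_; apply: h; rewrite ?mem_undup// -mem_undup.
Qed.

(** Boxes form a pi-system generating the sigma-algebra. Invariance of the law under exchanges of
    rows and under resampling of a coordinate both reduce to this uniqueness. *)
Lemma product_law_unique (I : choiceType) (k : I -> nat) nu
    (mu mu' : {measure set (config R I) -> \bar R}) :
  product_law k nu mu -> product_law k nu mu' ->
  forall A : set (config R I), measurable A -> mu A = mu' A.
Proof.
move=> h h' A mA.
apply: (@measure_unique _ R (config R I) (@boxes R I) (fun=> setT)) => //.
- exact: boxes_setI.
- by move=> _; exists [::], (fun=> setT); split=> //; apply/seteqP; split.
- by apply/seteqP; split=> // x _; exists 0%N.
- by move=> _ [s [B [mB ->]]]; rewrite box_undup h ?undup_uniq// h' ?undup_uniq.
- move=> _; have -> : [set: config R I] = box [::] (fun=> setT).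
    by apply/seteqP; split.
  by rewrite h// big_nil ltry.
Qed.

Section Reindex.
Variables (I J : choiceType) (k : I -> nat) (k' : J -> nat).
Variables (nu : nat -> probability R R) (mu : probability (config R I) R).
Variable f : J -> I.

Definition relabel (x : config R I) : config R J := fun j => x (f j).

Lemma measurable_relabel : measurable_fun setT relabel.
Proof. by apply: measurable_to_config => j; exact: measurable_coord. Qed.

HB.instance Definition _ := isMeasurableFun.Build _ _ _ _ relabel measurable_relabel.

(** Serves two purposes: a permutation [f] gives the exchange of two rows, and an embedding of
    [bool * nat] restricts a tree configuration to two of its rows. *)
Lemma product_law_relabel : injective f -> (forall j, k (f j) = k' j) ->
  product_law k nu mu -> product_law k' nu (distribution mu relabel).
Proof.
move=> finj fk h s B us mB; rewrite /distribution /pushforward.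
(* [C] moves the constraint on [j] to the coordinate [f j]; a preimage is sought only in the finite
   list [s]. *)
pose C i := if [pick j : seq_sub s | f (val j) == i] is Some j then B (val j) else setT.
have Cf j : j \in s -> C (f j) = B j.
  move=> js; rewrite /C; case: pickP => [j' /eqP/finj -> //|/(_ (SeqSub js))].
  by rewrite eqxx.
have -> : relabel @^-1` box s B = box [seq f j | j <- s] C.
  apply/seteqP; split=> x hx.
    by move=> _ /mapP[j js ->]; rewrite Cf//; exact: hx.
  by move=> j js; have := hx (f j) (map_f _ js); rewrite Cf.
rewrite h ?map_inj_uniq//; last by move=> i; rewrite /C; case: pickP.
by rewrite big_map big_seq [RHS]big_seq; apply: eq_bigr => j js; rewrite Cf// fk.
Qed.

End Reindex.

Section Resample.
Variables (I : choiceType) (k : I -> nat) (nu : nat -> probability R R).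
Variable (mu : probability (config R I) R).
Hypothesis hmu : product_law k nu mu.
Variable i : I.

Definition resample (z : R * config R I) : config R I :=
  fun j => if j == i then z.1 else z.2 j.

Lemma measurable_resample : measurable_fun setT resample.
Proof.
apply: measurable_to_config => j; rewrite /resample.
case: (j == i); first exact: measurable_fst.
exact: measurableT_comp (measurable_coord j) (@measurable_snd _ _ _ _).
Qed.

HB.instance Definition _ := isMeasurableFun.Build _ _ _ _ resample measurable_resample.

Lemma resample_law : product_law k nu (distribution (nu (k i) \x mu)%E resample).
Proof.
move=> s B us mB; rewrite /distribution /pushforward.
pose B0 := if i \in s then B i else setT.
have -> : resample @^-1` box s B = B0 `*` box (rem i s) B.
  apply/seteqP; split=> -[r x] /=.
    move=> h; split.
      by rewrite /B0; case: ifP => // /h; rewrite /resample eqxx.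
    move=> j; rewrite mem_rem_uniq// inE => /andP[/negPf ji js].
    by have := h j js; rewrite /resample ji.
  move=> [h1 h2] j js; rewrite /resample; case: eqVneq => [ji|ji].
    by subst j; move: h1; rewrite /B0 js.
  by apply: h2; rewrite mem_rem_uniq// inE ji.
have mB0 : measurable B0 by rewrite /B0; case: ifP.
rewrite [LHS](product_measure1E (nu (k i)) mu mB0 (measurable_box _ mB)).
rewrite [X in _ * X](hmu (rem_uniq i us) mB) /B0; case: ifPn => [si|si].
  by rewrite (perm_big _ (perm_to_rem si)) big_cons.
by rewrite rem_id// [X in X * _](probability_setT (nu (k i))) mul1e.
Qed.

(** The law does not change when coordinate [i] is replaced by an independent draw, so Tonelli on
    [nu (k i) \x mu] integrates one coordinate at a time. *)
Lemma integral_resample (F : config R I -> \bar R) :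
  measurable_fun setT F -> (forall x, 0 <= F x) ->
  \int[mu]_x F x = \int[mu]_y \int[nu (k i)]_r F (resample (r, y)).
Proof.
move=> mF F0.
transitivity (\int[distribution (nu (k i) \x mu)%E resample]_x F x).
  apply: eq_measure_integral => A mA _.
  exact: (product_law_unique hmu resample_law).
rewrite ge0_integral_distribution//.
apply: (@fubini_tonelli2 _ _ _ _ _ (nu (k i)) mu (F \o resample)) => //.
  by apply: measurableT_comp => //; exact: measurable_resample.
by move=> z; exact: F0.
Qed.

End Resample.

Lemma integral_prod_coord (I : choiceType) (k : I -> nat) nu (mu : probability (config R I) R)
    (s : seq I) (f : I -> R -> \bar R) : product_law k nu mu -> uniq s ->
  (forall i, measurable_fun setT (f i)) -> (forall i r, 0 <= f i r) ->
  \int[mu]_x (\prod_(i <- s) f i (x i)) = \prod_(i <- s) \int[nu (k i)]_r f i r.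
Proof.
move=> hmu us mf f0; elim: s us => [_|i s IH] /=.
  under eq_integral do rewrite big_nil.
  by rewrite big_nil integral_cst// mul1e; exact: probability_setT.
move=> /andP[nis us]; rewrite big_cons -IH//.
have mp t : measurable_fun setT (fun x : config R I => \prod_(i <- t) f i (x i)).
  elim: t => [|j t IHt].
    by apply: (eq_measurable_fun (cst 1)) => // x _; rewrite big_nil.
  apply: (eq_measurable_fun (fun x : config R I => f j (x j) * \prod_(i <- t) f i (x i))).
    by move=> x _; rewrite big_cons.
  apply: emeasurable_funM => //.
  exact: measurableT_comp (mf j) (measurable_coord j).
rewrite [LHS](@integral_resample _ _ _ _ hmu i)//; last first.
  by move=> x; apply: prode_ge0 => j _; exact: f0.
rewrite -ge0_integralZl//; first last.
- exact: integral_ge0.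
- by move=> x _; apply: prode_ge0 => j _; exact: f0.
apply: eq_integral => y _.
rewrite -ge0_integralZr//; last by apply: prode_ge0 => j _; exact: f0.
apply: eq_integral => r _.
rewrite big_cons /resample/= eqxx; congr (_ * _).
rewrite big_seq [RHS]big_seq; apply: eq_bigr => j js.
by case: eqVneq => // ji; move: nis; rewrite -ji js.
Qed.

End ProductLaw.

(** * Random walks with sign-symmetric increments *)

Section MeasurableEvents.
Context d (T : measurableType d) (R : realType).

Lemma measurable_forall (E : nat -> set T) :
  (forall n, measurable (E n)) -> measurable [set x | forall n, E n x].
Proof.
move=> mE; rewrite (_ : [set x | _] = \bigcap_n E n).
  exact: bigcapT_measurable.
by apply/seteqP; split=> x h n; [move=> _; exact: h|exact: h].
Qed.

Lemma measurable_exists (E : nat -> set T) :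
  (forall n, measurable (E n)) -> measurable [set x | exists n, E n x].
Proof.
move=> mE; rewrite (_ : [set x | _] = \bigcup_n E n).
  exact: bigcupT_measurable.
by apply/seteqP; split=> x [n]; exists n.
Qed.

Lemma measurable_conj (E F : set T) :
  measurable E -> measurable F -> measurable [set x | E x /\ F x].
Proof. exact: measurableI. Qed.

Lemma measurable_imp (c : Prop) (E : set T) :
  measurable E -> measurable [set x | c -> E x].
Proof.
move=> mE; have [hc|hc] := pselect c.
  by rewrite (_ : [set x | _] = E)//; apply/seteqP; split=> x h; first exact: h.
by rewrite (_ : [set x | _] = setT)//; apply/seteqP; split=> // x _ /hc.
Qed.

Lemma measurable_const (c : Prop) : measurable [set x : T | c].
Proof.
have [hc|hc] := pselect c.
  by rewrite (_ : [set x | _] = setT)//; apply/seteqP; split.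
by rewrite (_ : [set x | _] = set0)//; apply/seteqP; split.
Qed.

Lemma measurable_le (f g : T -> R) :
  measurable_fun setT f -> measurable_fun setT g -> measurable [set x | (f x <= g x)%R].
Proof.
move=> mf mg; have := measurable_fun_ler mf mg measurableT (I : measurable [set true]).
by rewrite setTI.
Qed.

Lemma measurable_lt (f g : T -> R) :
  measurable_fun setT f -> measurable_fun setT g -> measurable [set x | (f x < g x)%R].
Proof.
move=> mf mg; have := measurable_fun_ltr mf mg measurableT (I : measurable [set true]).
by rewrite setTI.
Qed.

Lemma measurable_eq (f g : T -> R) :
  measurable_fun setT f -> measurable_fun setT g -> measurable [set x | f x = g x].
Proof.
move=> mf mg; rewrite (_ : [set x | _] = [set x | (f x <= g x)%R] `&` [set x | (g x <= f x)%R]).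
  by apply: measurableI; exact: measurable_le.
apply/seteqP; split=> x /=; first by move=> ->.
by move=> [h1 h2]; apply/eqP; rewrite eq_le h1 h2.
Qed.

Lemma measurable_neq (f g : T -> R) :
  measurable_fun setT f -> measurable_fun setT g -> measurable [set x | f x <> g x].
Proof. by move=> mf mg; apply: measurableC; exact: measurable_eq. Qed.

End MeasurableEvents.

Ltac mevent := repeat first
  [ apply: measurable_imp | apply: measurable_forall => ? | apply: measurable_exists => ?
  | apply: measurable_conj | apply: measurable_const | apply: measurable_le
  | apply: measurable_lt | apply: measurable_neq | apply: measurable_eq ].

Section FatouSets.
Context d (T : measurableType d) (R : realType) (mu : probability T R).

(** Reverse Fatou for sets: the tail unions decrease to the limit superior, and each contains the
    set it starts with. *)
Lemma lim_sup_set_ge (F : nat -> set T) (p : \bar R) (m0 : nat) :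
  (forall n, measurable (F n)) -> (forall n, (m0 <= n)%N -> p <= mu (F n)) ->
  p <= mu (lim_sup_set F).
Proof.
move=> mF hp.
have h := @lim_sup_set_cvg _ _ _ mu F mF.
have /h {}h : mu (\bigcup_(k >= 0) F k) < +oo.
  apply: (le_lt_trans (probability_le1 _ _)); last exact: ltry.
  exact: bigcup_measurable.
rewrite -(cvg_lim _ h)//; apply: lime_ge; first by apply/cvg_ex; exists (mu (lim_sup_set F)).
exists m0 => // n /= m0n; apply: (le_trans (hp _ m0n)).
apply: le_measure; rewrite ?inE//; first exact: bigcup_measurable.
by move=> x Fx; exists n => //=.
Qed.

End FatouSets.

(** Cauchy's criterion with countable quantifiers only, which turns convergence into a measurable
    event. *)
Lemma cvg_seqP (R : realType) (s : nat -> R) :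
  cvgn s <-> forall k : nat, exists N, forall n, (N <= n)%N -> (`|s n - s N| <= k.+1%:R^-1)%R.
Proof.
split=> [cs k|h].
  have k0 : (0 < k.+1%:R^-1 / 2 :> R)%R by rewrite divr_gt0// invr_gt0.
  have [l /cvgrPdist_le/(_ _ k0)[N _ hN]] := (cvg_ex _).1 cs.
  exists N => n Nn; have h1 := hN n Nn; have h2 := hN N (leqnn N).
  rewrite (splitr k.+1%:R^-1) (_ : s n - s N = (l - s N) - (l - s n))%R; last by ring.
  by rewrite (le_trans (ler_normB _ _))// lerD.
apply/cauchy_cvgP/cauchy_exP => e e0.
have [k ke] : exists k : nat, (k.+1%:R^-1 < e)%R.
  exists (Num.bound e^-1)%R; rewrite invf_plt ?posrE//.
  by rewrite (lt_trans (unstable.ltr_bound _))// ltr_nat.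
have [N hN] := h k; exists (s N); exists N => // n /= Nn.
by rewrite /ball/= distrC (le_lt_trans (hN n Nn)).
Qed.

Lemma eventually_le_bounded (R : realType) (s : nat -> R) K (c : R) :
  (forall n, (K <= n)%N -> (s n <= c)%R) -> exists c', forall n, (s n <= c')%R.
Proof.
elim: K c => [|K IH] c h; first by exists c => n; exact: h.
apply: (IH (Num.max c (s K))) => n; rewrite leq_eqVlt => /orP[/eqP <-|/h hn].
  by rewrite le_max lexx orbT.
by rewrite le_max hn.
Qed.

Section SignSymmetric.
Context d (T : measurableType d) (R : realType) (mu : probability T R).
Variables (D : nat -> T -> R) (phi : pred nat -> T -> T).
Hypothesis mD : forall n, measurable_fun setT (D n).
Hypothesis mphi : forall a, measurable_fun setT (phi a).
Hypothesis phi_inv : forall a A, measurable A -> mu (phi a @^-1` A) = mu A.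
Hypothesis D_phi : forall a j x, D j (phi a x) = (if a j then - D j x else D j x)%R.

Definition psum n x : R := (\sum_(j < n) D j x)%R.
Local Notation S := psum.

Lemma measurable_psum n : measurable_fun setT (S n).
Proof. by apply: measurable_sum => i; exact: mD. Qed.

Lemma psumS n x : (S n.+1 x = S n x + D n x)%R.
Proof. by rewrite /psum big_ord_recr. Qed.

Lemma measurable_preimage_phi a A : measurable A -> measurable (phi a @^-1` A).
Proof. by move=> mA; rewrite -[X in measurable X]setTI; exact: mphi. Qed.

Lemma psum_flip_tail m k x : S k (phi (fun j => m <= j)%N x) =
  (if (k <= m)%N then S k x else S m x *+ 2 - S k x)%R.
Proof.
elim: k => [|k IH]; first by rewrite /psum !big_ord0.
rewrite psumS IH D_phi psumS; case: (ltngtP k m) => // h.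
- by rewrite opprD addrA.
- by subst m; rewrite mulr2n; ring.
Qed.

(* Flipping all increments after time [m] reflects the path at [S m].  If the reflected path
   is bounded by [c] for infinitely many [m], then [S] itself is bounded on both sides; by the
   reverse Fatou lemma this event is at least as likely as [S <= c]. *)
Lemma bounded_above_below (c : R) :
  mu [set x | (forall k, S k x <= c)%R /\ ~ exists n : nat, forall k, (- n%:R <= S k x)%R] = 0.
Proof.
pose F := [set x | forall k, (S k x <= c)%R].
pose B := [set x | exists n : nat, forall k, (- n%:R <= S k x)%R].
have mF : measurable F by mevent; [exact: measurable_psum|exact: measurable_cst].
have mB : measurable B by mevent; [exact: measurable_cst|exact: measurable_psum].
pose F' m := phi (fun j => m <= j)%N @^-1` F.
have mF' m : measurable (F' m) by exact: measurable_preimage_phi.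
have h1 : mu F <= mu (lim_sup_set F').
  by apply: (@lim_sup_set_ge _ _ _ _ _ _ 0) => // n _; rewrite phi_inv.
have h2 : lim_sup_set F' `<=` F `&` B.
  move=> x hx; split.
    (* Times up to [m] are untouched by the flip, so arbitrarily large [m] give the upper bound at
       every time. For the lower bound a single [m] suffices: later values satisfy
       [S k >= S m *+ 2 - c], and only finitely many times precede it. *)
    move=> k; have [m /= km] := hx k I; move/(_ k).
    by rewrite psum_flip_tail km.
  have [m _ hm] := hx 0%N I.
  have [k mk|b hb] := @eventually_le_bounded _ (fun k => - S k x)%R m.+1 (c - S m x *+ 2)%R.
    by have := hm k; rewrite psum_flip_tail leqNgt mk/=; lra.
  exists (Num.bound b) => k; rewrite lerNl (le_trans (hb k))// ltW//.
  exact: unstable.ltr_bound.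
have mL : measurable (lim_sup_set F').
  by apply: bigcap_measurable => // n _; exact: bigcup_measurable.
have h3 : mu F = mu (F `&` B).
  apply/eqP; rewrite eq_le; apply/andP; split.
    by apply: (le_trans h1); apply: le_measure; rewrite ?inE//; exact: measurableI.
  by apply: le_measure; rewrite ?inE//; exact: measurableI.
transitivity (mu F - mu (F `&` B)).
  by apply: measureD => //; rewrite (le_lt_trans (probability_le1 _ _))// ltry.
by rewrite h3 subee// fin_num_measure//; exact: measurableI.
Qed.

Lemma integral_phi a (F : T -> \bar R) : measurable_fun setT F -> (forall x, 0 <= F x) ->
  \int[mu]_x F (phi a x) = \int[mu]_x F x.
Proof.
move=> mF F0.
pose X : {mfun T >-> T} := HB.pack (phi a) (isMeasurableFun.Build _ _ _ _ (phi a) (mphi a)).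
rewrite -(@ge0_integral_distribution _ _ _ _ _ mu X F)//.
by apply: eq_measure_integral => A mA _; exact: phi_inv.
Qed.

(** A martingale transform of the walk: increment [D k] is added only if the gate is open, given the
    current value of the transform itself. *)
Fixpoint gated (h : nat -> R -> T -> bool) n x : R :=
  if n is k.+1 then (gated h k x + (h k (gated h k x) x)%:R * D k x)%R else 0%R.

(** The case [k = n] is included, so a gate may depend on the modulus of the very increment it
    controls, but not on its sign. This is weaker than predictability and permits the truncation of
    large increments. *)
Definition adapted (h : nat -> R -> T -> bool) :=
  (forall n k r x, (k <= n)%N -> h k r (phi (pred1 n) x) = h k r x) /\
  (forall k (f : T -> R), measurable_fun setT f -> measurable_fun setT (fun x => h k (f x) x)).

Section Gated.
Variable h : nat -> R -> T -> bool.
Hypothesis ha : adapted h.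
Local Notation M := (gated h).
Local Notation g := (fun n x => (h n (M n x) x)%:R : R).

Lemma gated_flip n k x : (k <= n)%N -> M k (phi (pred1 n) x) = M k x.
Proof.
elim: k => [//|k IH] kn /=; rewrite IH ?(ltnW kn)// ha.1 ?(ltnW kn)// D_phi.
by rewrite /= ltn_eqF.
Qed.

Lemma measurable_natr_bool (b : T -> bool) :
  measurable_fun setT b -> measurable_fun setT (fun x => (b x)%:R : R).
Proof.
move=> mb; rewrite (_ : (fun x => _) = (fun x => if b x then 1 else 0)%R).
  by apply: measurable_fun_ifT.
by apply/funext => x; case: (b x).
Qed.

Lemma measurable_gated n : measurable_fun setT (M n).
Proof.
elim: n => [|n IH] /=; first exact: measurable_cst.
apply: measurable_funD => //; apply: measurable_funM => //.
by apply: measurable_natr_bool; exact: ha.2.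
Qed.

Lemma measurable_gate n : measurable_fun setT (g n).
Proof. by apply: measurable_natr_bool; apply: ha.2; exact: measurable_gated. Qed.

(* Averaging over the sign of [D n] removes the cross term of the square. *)
Lemma gated_energy n : \int[mu]_x ((M n x) ^+ 2)%:E =
  \sum_(i < n) \int[mu]_x (g i x * D i x ^+ 2)%:E.
Proof.
elim: n => [|n IH].
  by rewrite big_ord0 /= expr0n/= integral0.
rewrite big_ord_recr -IH [in RHS]/=.
have mM := measurable_gated; have mg := measurable_gate.
have half0 : (0 <= 2^-1 :> R)%R by rewrite invr_ge0.
have mH : measurable_fun setT (fun x => (2^-1 * M n.+1 x ^+ 2)%:E).
  by apply/measurable_EFinP; apply: measurable_funM => //; exact: measurable_funX.
rewrite -ge0_integralD//; last 4 first.
- by move=> x _; rewrite lee_fin sqr_ge0.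
- by apply/measurable_EFinP; exact: measurable_funX.
- by move=> x _; rewrite lee_fin mulr_ge0 ?sqr_ge0.
- by apply/measurable_EFinP; apply: measurable_funM; [exact: mg|exact: measurable_funX].
transitivity (\int[mu]_x (2^-1 * M n.+1 x ^+ 2)%:E + \int[mu]_x (2^-1 * M n.+1 x ^+ 2)%:E).
  rewrite -ge0_integralD//; try by move=> x _; rewrite lee_fin mulr_ge0// sqr_ge0.
  by apply: eq_integral => x _; rewrite -EFinD; congr (_ %:E); field.
rewrite -[X in _ + X](integral_phi (pred1 n))//; last first.
  by move=> x; rewrite lee_fin mulr_ge0// sqr_ge0.
rewrite -ge0_integralD//; last 3 first.
- by move=> x _; rewrite lee_fin mulr_ge0// sqr_ge0.
- by move=> x _; rewrite lee_fin mulr_ge0// sqr_ge0.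
- exact: measurableT_comp mH (mphi _).
apply: eq_integral => x _; rewrite -!EFinD; congr (_ %:E).
rewrite /= gated_flip// ha.1// D_phi/= eqxx.
by case: (h n _ _) => /=; field.
Qed.

End Gated.

(** A path staying in [[-c, c]] has increments of modulus at most [c *+ 2], so on such a path this
    gate never closes and the gated walk is the walk itself. *)
Definition in_band (c : R) n (r : R) x := (`|r| <= c)%R && (`|D n x| <= c *+ 2)%R.

Lemma measurable_norm_le (f : T -> R) (c : R) : measurable_fun setT f ->
  measurable_fun setT (fun x => (`|f x| <= c)%R).
Proof.
move=> mf; apply: (measurable_fun_ler (f := fun x => `|f x|%R) (g := cst c)) => //.
by apply: measurableT_comp.
Qed.

Lemma in_band_adapted c : adapted (in_band c).
Proof.
split=> [n k r x kn|k f mf].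
  by rewrite /in_band D_phi; case: ifP => // _; rewrite normrN.
by apply: measurable_and; exact: measurable_norm_le.
Qed.

(** Watches the [h]-gated walk from time [m] on and freezes it once it has moved by more than [e]. A
    large displacement then persists at all later times, so Chebyshev's inequality at one late time
    controls the maximal displacement. *)
Definition restarted (h : nat -> R -> T -> bool) (e : R) m n (r : R) x :=
  [&& (m <= n)%N, (`|r| <= e)%R & h n (gated h n x) x].

Lemma restarted_adapted h e m : adapted h -> adapted (restarted h e m).
Proof.
move=> ha; split=> [n k r x kn|k f mf].
  by rewrite /restarted gated_flip// ha.1.
apply: measurable_and; first exact: measurable_cst.
apply: measurable_and; first exact: measurable_norm_le.
by apply: ha.2; exact: measurable_gated.
Qed.

(** A step starts within distance [c] of the origin and has length at most [c *+ 2]. *)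
Lemma gated_in_band_bound c n x : (0 <= c)%R -> (`|gated (in_band c) n x| <= c *+ 3)%R.
Proof.
move=> c0; elim: n => [|n IH] /=; first by rewrite normr0 mulrn_wge0.
case: (boolP (in_band _ _ _ _)) => [/andP[h1 h2]|_]; last by rewrite mul0r addr0.
rewrite mul1r; apply: (le_trans (ler_normD _ _)); lra.
Qed.

Lemma gated_in_band_psum c n x : (forall k, `|S k x| <= c)%R ->
  gated (in_band c) n x = S n x.
Proof.
move=> hc; elim: n => [|n IH]; first by rewrite /= /psum big_ord0.
rewrite /= IH psumS; suff -> : in_band c n (S n x) x by rewrite mul1r.
rewrite /in_band hc/=; have -> : D n x = (S n.+1 x - S n x)%R by rewrite psumS; ring.
by rewrite (le_trans (ler_normB _ _))// mulr2n lerD.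
Qed.

Lemma gated_restarted_lt h e m n x : (n <= m)%N -> gated (restarted h e m) n x = 0%R.
Proof.
elim: n => [//|n IH] nm /=; rewrite IH ?(ltnW nm)// /restarted leqNgt nm/=.
by rewrite mul0r addr0.
Qed.

Lemma gated_restarted h e m n x : (forall k, `|gated (restarted h e m) k x| <= e)%R ->
  (m <= n)%N -> gated (restarted h e m) n x = (gated h n x - gated h m x)%R.
Proof.
move=> he; elim: n => [|n IH].
  by rewrite leqn0 => /eqP ->; rewrite subrr.
rewrite leq_eqVlt => /orP[/eqP <-|mn].
  by rewrite gated_restarted_lt// subrr.
have {}mn : (m <= n)%N by [].
rewrite /=; have -> : restarted h e m n (gated (restarted h e m) n x) x = h n (gated h n x) x.
  by rewrite /restarted mn he.
by rewrite IH//; ring.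
Qed.

Lemma gated_restarted_stop h e m n x : (e < `|gated (restarted h e m) n x|)%R ->
  (e < `|gated (restarted h e m) n.+1 x|)%R.
Proof.
move=> h1 /=; have -> : restarted h e m n (gated (restarted h e m) n x) x = false.
  by rewrite /restarted [X in _ && (X && _)]leNgt h1 andbF.
by rewrite mul0r addr0.
Qed.

Lemma chebyshev_sqr (f : T -> R) (e : R) : (0 < e)%R -> measurable_fun setT f ->
  mu [set x | (e < `|f x|)%R] <= (e ^- 2)%:E * \int[mu]_x ((f x) ^+ 2)%:E.
Proof.
move=> e0 mf.
have mE : measurable [set x | (e < `|f x|)%R].
  by apply: measurable_lt => //; exact: measurableT_comp.
rewrite -(setIT [set x | _]) -integral_indic// -ge0_integralZl//; last 3 first.
- by apply/measurable_EFinP; exact: measurable_funX.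
- by move=> x _; rewrite lee_fin sqr_ge0.
- by rewrite lee_fin invr_ge0 sqr_ge0.
apply: ge0_le_integral => //.
- by apply/measurable_EFinP; exact: measurable_indic.
- apply/measurable_EFinP; apply: measurable_funM => //; exact: measurable_funX.
move=> x _; rewrite -EFinM lee_fin indicE; case: (boolP (x \in _)) => [|_].
  rewrite inE /= => ex.
  have : (e ^+ 2 <= f x ^+ 2)%R.
    by rewrite -(real_normK (num_real (f x))) lerXn2r ?nnegrE ?(ltW e0)// ltW.
  have e2 : (0 < e ^+ 2)%R by rewrite exprn_gt0.
  by rewrite mulr1n -(mulVf (lt0r_neq0 e2)) ler_pM2l ?invr_gt0.
by rewrite mulr_ge0 ?invr_ge0 ?sqr_ge0.
Qed.

(** Kolmogorov's maximal inequality for the walk gated by the band. The energies [a i] sum to at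
    most the square of the bound [c *+ 3], so their tails vanish, and the tail from [m] bounds the
    probability of ever moving more than [e] away from the value at time [m]. *)
Lemma bounded_psum_cauchy (c e : R) : (0 <= c)%R -> (0 < e)%R ->
  mu [set x | (forall k, `|S k x| <= c)%R /\
    (forall m, exists n, (m <= n)%N /\ (e < `|S n x - S m x|)%R)] = 0.
Proof.
move=> c0 e0; pose h := in_band c; have ha : adapted h := in_band_adapted c.
pose a i := \int[mu]_x ((h i (gated h i x) x)%:R * D i x ^+ 2)%:E.
have a0 i : 0 <= a i.
  by apply: integral_ge0 => x _; rewrite lee_fin mulr_ge0// sqr_ge0.
have sa n : \sum_(i < n) a i <= ((c *+ 3) ^+ 2)%:E.
  rewrite -gated_energy//.
  rewrite (_ : _%:E = \int[mu]_x (cst ((c *+ 3) ^+ 2)%:E) x); last first.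
    by rewrite integral_cst// [X in _ * X](probability_setT mu) mule1.
  apply: ge0_le_integral => //.
  - by move=> x _; rewrite lee_fin sqr_ge0.
  - by apply/measurable_EFinP; apply: measurable_funX; exact: measurable_gated.
  move=> x _; rewrite lee_fin -real_normK ?num_real// lerXn2r ?nnegrE ?mulrn_wge0//.
  exact: gated_in_band_bound.
have aoo : \sum_(0 <= i <oo) a i < +oo.
  apply: (@le_lt_trans _ _ ((c *+ 3) ^+ 2)%:E); last exact: ltry.
  apply: lime_le; first exact: is_cvg_nneseries.
  by apply: nearW => n; rewrite big_mkord.
pose B m := [set x | exists N, (e < `|gated (restarted h e m) N x|)%R].
have mM m N := measurable_gated (restarted_adapted e m ha) N.
have mBN m N : measurable [set x | (e < `|gated (restarted h e m) N x|)%R].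
  by apply: measurable_lt => //; exact: measurableT_comp.
have mB m : measurable (B m) by apply: measurable_exists => N; exact: mBN.
have hB m : mu (B m) <= (e ^- 2)%:E * \sum_(m <= i <oo) a i.
  pose BN N := [set x | (e < `|gated (restarted h e m) N x|)%R].
  have -> : B m = \bigcup_N BN N by apply/seteqP; split=> x [N]; exists N.
  have hcvg : mu (BN N) @[N --> \oo] --> mu (\bigcup_N BN N).
    apply: nondecreasing_cvg_mu; first exact: mBN.
      by apply: bigcupT_measurable; exact: mBN.
    by apply/nondecreasing_seqP => N; apply/subsetPset => x; exact: gated_restarted_stop.
  rewrite -(cvg_lim _ hcvg)//; apply: lime_le; first by apply/cvg_ex; eexists; exact: hcvg.
  apply: nearW => N.
  apply: (le_trans (chebyshev_sqr e0 (mM m N))).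
  rewrite lee_pmul2l ?lte_fin ?invr_gt0 ?exprn_gt0// gated_energy; last exact: restarted_adapted.
  (* The restarted gate is open at [i] only if [m <= i] and the original gate is open, so its energy
     is dominated by the tail. *)
  have hle i : \int[mu]_x ((restarted h e m i (gated (restarted h e m) i x) x)%:R * D i x ^+ 2)%:E
      <= if (m <= i)%N then a i else 0.
    case: ifPn => mi; last first.
      by rewrite integral0_eq// => x _; rewrite /restarted (negbTE mi) mul0r.
    apply: ge0_le_integral => //.
    - by move=> x _; rewrite lee_fin mulr_ge0 ?sqr_ge0.
    - apply/measurable_EFinP; apply: measurable_funM; last exact: measurable_funX.
      exact: measurable_gate (restarted_adapted e m ha) i.
    - apply/measurable_EFinP; apply: measurable_funM; last exact: measurable_funX.
      exact: measurable_gate ha i.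
    move=> x _; rewrite lee_fin ler_wpM2r ?sqr_ge0// ler_nat /restarted mi/=.
    by case: (_ <= e)%R.
  apply: (@le_trans _ _ (\sum_(i < N) if (m <= i)%N then a i else 0)).
    by apply: lee_sum => i _; exact: hle.
  apply: (@le_trans _ _ (\sum_(m <= i < N) a i)).
    rewrite -(big_mkord xpredT (fun i => if (m <= i)%N then a i else 0)) -big_mkcond/=.
    by rewrite [leRHS](big_nat_widenl _ 0).
  exact: nneseries_lim_ge.
apply/eqP; rewrite eq_le measure_ge0 andbT.
have hA m : [set x | (forall k, `|S k x| <= c)%R /\
    (forall m, exists n, (m <= n)%N /\ (e < `|S n x - S m x|)%R)] `<=` B m.
  move=> x [hc hn]; apply: contrapT => nB.
  have hk k : (`|gated (restarted h e m) k x| <= e)%R.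
    by rewrite leNgt; apply/negP => hlt; apply: nB; exists k.
  have [n [mn]] := hn m; apply/negP; rewrite -leNgt.
  by rewrite -!(gated_in_band_psum _ hc) -(gated_restarted hk mn).
have : (e ^- 2)%:E * \sum_(m <= i <oo) a i @[m --> \oo] --> (e ^- 2)%:E * 0.
  by apply: cvgeZl => //; exact: nneseries_tail_cvg.
rewrite mule0 => hc0; rewrite -(cvg_lim _ hc0)//; apply: lime_ge.
  by apply/cvg_ex; eexists; exact: hc0.
apply: nearW => m; apply: le_trans (hB m); apply: le_measure; rewrite ?inE//.
by mevent; do ?[exact: measurable_cst|apply: measurableT_comp => //;
  try apply: measurable_funB; exact: measurable_psum].
Qed.

Lemma null_ae (A : set T) : measurable A -> mu A = 0 -> {ae mu, forall x, ~ A x}.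
Proof. by move=> mA A0; exists A; split=> // x /= /contrapT. Qed.

(** An upper bound is first upgraded to bounds on both sides, and then the energy estimate applies.
    Integer levels and accuracies [j.+1%:R^-1] keep the exceptional null sets countable in
    number. *)
Lemma bounded_above_cvg :
  {ae mu, forall x, (exists c : R, forall k, S k x <= c)%R -> cvgn (S ^~ x)}.
Proof.
pose lower (c : nat) := [set x | (forall k, S k x <= c%:R)%R /\
  ~ exists n : nat, forall k, (- n%:R <= S k x)%R].
pose osc (c j : nat) := [set x | (forall k, `|S k x| <= c%:R)%R /\
    (forall m, exists n, (m <= n)%N /\ (j.+1%:R^-1 < `|S n x - S m x|)%R)].
have mS := measurable_psum.
have h1 : {ae mu, forall x (c : nat), ~ lower c x}.
  apply: ae_foralln => c; apply: null_ae; last exact: bounded_above_below.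
  apply: measurable_conj; first by mevent; [exact: mS|exact: measurable_cst].
  by apply: measurableC; mevent; [exact: measurable_cst|exact: mS].
have h2 : {ae mu, forall x (c j : nat), ~ osc c j x}.
  apply: ae_foralln => c; apply: ae_foralln => j; apply: null_ae.
    by mevent; do ?[exact: measurable_cst|apply: measurableT_comp => //;
      try apply: measurable_funB; exact: measurable_psum].
  by apply: bounded_psum_cauchy; rewrite ?invr_gt0.
apply: filterS2 h1 h2 => x n1 n2 [c hc].
have [n hn] : exists n : nat, forall k, (- n%:R <= S k x)%R.
  apply: contrapT => hn; apply: (n1 (Num.bound c)); split=> // k.
  rewrite (le_trans (hc k))// (le_trans (ler_norm _))// ltW//.
  exact: unstable.ltr_norm_bound.
pose c' := maxn (Num.bound c) n.
have hc' k : (`|S k x| <= c'%:R)%R.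
  rewrite ler_norml; apply/andP; split.
    by apply: le_trans (hn k); rewrite lerN2 ler_nat leq_maxr.
  rewrite (le_trans (hc k))// (le_trans (ltW (unstable.ltr_bound c)))//.
  by rewrite ler_nat leq_maxl.
apply/cvg_seqP => j; apply: contrapT => /forallNP hj; apply: (n2 c' j); split=> // m.
have /existsNP[k hk] := hj m; have [mk /negP] := (not_implyP _ _).1 hk.
by rewrite -ltNge => ?; exists k.
Qed.

Lemma psum_flip1 i n x : S n (phi (pred1 i) x) =
  (if (i < n)%N then S n x - D i x *+ 2 else S n x)%R.
Proof.
elim: n => [|n IH]; first by rewrite /psum !big_ord0.
rewrite psumS IH D_phi psumS /= ltnS; case: (ltngtP i n) => h.
- by ring.
- by [].
- by subst i; ring.
Qed.

(* If [Y + S] crosses zero forever then it tends to zero and has infinitely many nonzero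
   increments.  Flipping the first nonzero increment [D i] after time [m] preserves the
   probability of this event and moves the limit to [D i *+ 2]; as the increments tend to
   zero, this limit can be attained for finitely many [m] only. *)
Lemma no_crossing (Y : T -> R) (m0 : nat) : measurable_fun setT Y ->
  (forall i x, (m0 <= i)%N -> Y (phi (pred1 i) x) = Y x) ->
  {ae mu, forall x, cvgn (S ^~ x) ->
    (exists N, forall n, (N <= n)%N -> (Y x + S n x <= 0)%R) \/
    (exists N, forall n, (N <= n)%N -> (0 <= Y x + S n x)%R)}.
Proof.
move=> mY hY.
have mS := measurable_psum.
have mW n : measurable_fun setT (fun x => Y x + S n x)%R by exact: measurable_funD.
pose F := [set x | (forall k, exists N, forall n, (N <= n)%N ->
    (`|Y x + S n x| <= k.+1%:R^-1)%R) /\ (forall N, exists i, (N <= i)%N /\ D i x <> 0%R)].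
have mF : measurable F.
  by rewrite /F; mevent => //; [apply: measurableT_comp => //; exact: mW].
pose G m i := [set x | D i x <> 0%R /\ forall j, (m <= j)%N -> (j < i)%N -> D j x = 0%R].
have mG m i : measurable (G m i) by rewrite /G; mevent => //; exact: mD.
(* [G m i] involves the increments only through their vanishing, so the flip at [i] preserves it. *)
have Gphi m i : phi (pred1 i) @^-1` (G m i `&` F) = G m i `&` phi (pred1 i) @^-1` F.
  rewrite preimage_setI; congr (_ `&` _); apply/seteqP; split=> x [h1 h2]; split.
  - by move: h1; rewrite D_phi/= eqxx => h1 hD; apply: h1; rewrite hD oppr0.
  - by move=> j mj ji; have := h2 j mj ji; rewrite D_phi/= ltn_eqF.
  - by rewrite D_phi/= eqxx => /eqP; rewrite oppr_eq0 => /eqP.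
  - by move=> j mj ji; rewrite D_phi/= ltn_eqF//; exact: h2.
pose F' m := \bigcup_l (G m (m + l)%N `&` phi (pred1 (m + l)%N) @^-1` F).
have mGF m i : measurable (G m i `&` phi (pred1 i) @^-1` F).
  by apply: measurableI => //; exact: measurable_preimage_phi.
have mF' m : measurable (F' m) by apply: bigcupT_measurable => l; exact: mGF.
(* On [F] there is a first nonzero increment from [m] on, so the disjoint sets [G m (m + l)] cover
   [F], and each piece keeps its probability under its own flip. *)
have hFF' m : mu F <= mu (F' m).
  rewrite (measure_semi_bigcup mu (fun l => mGF m (m + l)%N))//; last 2 first.
    apply/trivIsetP => l1 l2 _ _ /eqP l12; apply/seteqP; split=> // x [[[h1 h2] _] [[h3 h4] _]].
    case: (ltngtP l1 l2) => // h.
    - by apply: h1; apply: h4; rewrite ?leq_addr ?ltn_add2l.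
    - by apply: h3; apply: h2; rewrite ?leq_addr ?ltn_add2l.
    exact: mF'.
  rewrite (_ : \sum_(0 <= i <oo) _ = \sum_(0 <= l <oo) mu (G m (m + l)%N `&` F)).
    apply: measure_sigma_subadditive => //.
      by move=> l; apply: measurableI.
    move=> x Fx; have [_ hN] := Fx.
    have ex : exists l, D (m + l)%N x != 0%R.
      have [i [mi Di]] := hN m; exists (i - m)%N; rewrite subnKC//.
      exact/eqP.
    have [l Dl lmin] := ex_minnP ex.
    exists l => //; split=> //; split; first exact/eqP.
    move=> j mj jl; apply/eqP; apply: contraT => Dj.
    have := lmin (j - m)%N; rewrite subnKC// => /(_ Dj).
    by rewrite leqNgt ltn_subLR// jl.
  apply: eq_eseriesr => l _; rewrite -Gphi; apply: phi_inv.
  exact: measurableI.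
have F0 : mu F = 0.
  apply/eqP; rewrite eq_le measure_ge0 andbT -(measure0 mu).
  rewrite (_ : set0 = lim_sup_set F').
    by apply: (@lim_sup_set_ge _ _ _ _ _ _ m0) => // n _; exact: hFF'.
  apply/esym/seteqP; split=> // x hx.
  have key m : exists2 i, (m <= i)%N & D i x <> 0%R /\
      (Y x + S n x)%R @[n --> \oo] --> (D i x *+ 2)%R.
    have [m' /= mm' [l _ [[Di _] [h _]]]] := hx (maxn m m0) I.
    exists (m' + l)%N; first by rewrite (leq_trans (leq_maxl m m0))// (leq_trans mm')// leq_addr.
    split=> //; apply/cvgrPdist_le => e e0.
    have [k ke] : exists k : nat, (k.+1%:R^-1 < e)%R.
      exists (Num.bound e^-1)%R; rewrite invf_plt ?posrE//.
      by rewrite (lt_trans (unstable.ltr_bound _))// ltr_nat.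
    have [N hN] := h k; exists (maxn N (m' + l).+1) => // n /=.
    rewrite geq_max => /andP[Nn ln]; apply: le_trans (ltW ke).
    have := hN n Nn; rewrite psum_flip1 ln hY; last first.
      by rewrite (leq_trans (leq_maxr m m0))// (leq_trans mm')// leq_addr.
    by rewrite distrC; congr (`|_| <= _)%R; ring.
  have [i1 _ [Di1 c1]] := key 0%N.
  have c2 : D n x @[n --> \oo] --> 0%R.
    have c1' : (Y x + S n.+1 x)%R @[n --> \oo] --> (D i1 x *+ 2)%R.
      by rewrite (cvg_shiftS (fun n => Y x + S n x)%R).
    have -> : (fun n => D n x) = (fun n => (Y x + S n.+1 x) - (Y x + S n x))%R.
      by apply/funext => n; rewrite psumS; ring.
    by rewrite -(subrr (D i1 x *+ 2)%R); exact: cvgB.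
  have Di1p : (0 < `|D i1 x|)%R by rewrite normr_gt0; apply/eqP.
  have /cvgrPdist_lt/(_ _ Di1p)[N _ hN] := c2.
  have [i2 Ni2 [Di2 c3]] := key N.
  have E2 : (D i1 x *+ 2 = D i2 x *+ 2)%R by exact: (cvg_unique _ c1 c3).
  have E : D i1 x = D i2 x by move: E2; lra.
  by have := hN i2 Ni2; rewrite /= sub0r normrN E ltxx.
have := null_ae mF F0; apply: filterS => x nF cS.
have [hD|hD] := pselect (forall N, exists i, (N <= i)%N /\ D i x <> 0%R); last first.
  have /existsNP[N hN] := hD.
  have hS n : (N <= n)%N -> S n x = S N x.
    elim: n => [|n IH]; first by rewrite leqn0 => /eqP ->.
    rewrite leq_eqVlt => /orP[/eqP ->//|Nn].
    rewrite psumS IH//; have [->|Dn] := eqVneq (D n x) 0%R; first by rewrite addr0.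
    by exfalso; apply: hN; exists n; split=> //; exact/eqP.
  case: (leP (Y x + S N x)%R 0%R) => h; [left|right]; exists N => n Nn; rewrite hS//.
  exact: ltW.
have [l cl] := (cvg_ex _).1 cS.
have cW : (Y x + S n x)%R @[n --> \oo] --> (Y x + l)%R by apply: cvgD => //; exact: cvg_cst.
case: (ltgtP (Y x + l)%R 0%R) => h.
- left; have [N _ hN] := cvgr_lt _ cW _ h.
  by exists N => n Nn; apply: ltW; exact: hN.
- right; have [N _ hN] := cvgr_gt _ cW _ h.
  by exists N => n Nn; apply: ltW; exact: hN.
exfalso; apply: nF; split=> // k.
have k0 : (0 < k.+1%:R^-1 :> R)%R by rewrite invr_gt0.
have /cvgrPdist_le/(_ _ k0)[N _ hN] := cW.
by exists N => n /hN; rewrite /= h sub0r normrN.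
Qed.

(* Flip all increments after the first passage above zero. *)
Lemma levy_inequality (Y : T -> R) (k0 N : nat) : measurable_fun setT Y ->
  (forall (a : pred nat) x, (forall j, a j -> (k0 <= j)%N) -> Y (phi a x) = Y x) ->
  mu [set x | exists n, (k0 <= n <= N)%N /\ (0 < Y x + S n x)%R] <=
  2%:E * mu [set x | (0 < Y x + S N x)%R].
Proof.
move=> mY hY.
have mW n : measurable_fun setT (fun x => Y x + S n x)%R.
  by apply: measurable_funD => //; exact: measurable_psum.
pose G n := [set x | (k0 <= n <= N)%N /\ (0 < Y x + S n x)%R /\
  forall j, (k0 <= j < n)%N -> (Y x + S j x <= 0)%R].
have mG n : measurable (G n) by rewrite /G; mevent => //; exact: mW.
pose U := [set x | (0 < Y x + S N x)%R].
have mU : measurable U by apply: measurable_lt => //; exact: mW.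
have mGU n : measurable (G n `&` U) by exact: measurableI.
have hG n : mu (G n) <= 2%:E * mu (G n `&` U).
  pose p := phi (fun j => n <= j)%N.
  have hsub : G n `<=` (G n `&` U) `|` p @^-1` (G n `&` U).
    move=> x Gx; have [/andP[kn nN] [h1 h2]] := Gx.
    have Yp : Y (p x) = Y x by apply: hY => j; exact: leq_trans.
    case: (ltP 0%R (Y x + S N x)%R) => hU; [by left|right].
    have Sp j : (j <= n)%N -> S j (p x) = S j x by move=> jn; rewrite psum_flip_tail jn.
    split.
      split; first by rewrite kn nN.
      rewrite Yp Sp//; split=> // j kj; rewrite Sp ?h2//.
      by case/andP: kj => _ /ltnW.
    (* For [n < N] the flipped walk ends at twice the positive first-passage value minus the
       nonpositive value at [N]. For [n = N] the first passage contradicts [hU]. *)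
    rewrite /U /= Yp psum_flip_tail; case: ifPn => Nn; last by lra.
    have E : n = N by apply/eqP; rewrite eqn_leq nN Nn.
    by move: h1 hU; rewrite E; lra.
  have mp : measurable (p @^-1` (G n `&` U)) by exact: measurable_preimage_phi.
  apply: (@le_trans _ _ (mu ((G n `&` U) `|` p @^-1` (G n `&` U)))).
    by apply: le_measure; rewrite ?inE//; exact: measurableU.
  apply: (@le_trans _ _ (mu (G n `&` U) + mu (p @^-1` (G n `&` U)))).
    exact: measureU2.
  rewrite phi_inv//.
  by rewrite mule_natl mule2n.
have tG : trivIset setT G.
  apply/trivIsetP => n1 n2 _ _ /eqP n12; apply/seteqP; split=> // x.
  move=> [[/andP[a1 _] [a2 a3]] [/andP[b1 _] [b2 b3]]].
  case: (ltngtP n1 n2) => // h.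
    by have := b3 n1; rewrite a1 h => /(_ isT); rewrite leNgt a2.
  by have := a3 n2; rewrite b1 h => /(_ isT); rewrite leNgt b2.
apply: (@le_trans _ _ (\sum_(0 <= n <oo) mu (G n))).
  apply: measure_sigma_subadditive => //; first by mevent => //; exact: mW.
  move=> x [n [/andP[kn nN] Wn]].
  have ex : exists n, (k0 <= n <= N)%N && (0 < Y x + S n x)%R.
    by exists n; rewrite kn nN.
  have [i /andP[/andP[ki iN] Wi] imin] := ex_minnP ex.
  exists i => //; split; first by rewrite ki iN.
  split=> // j /andP[kj ji]; rewrite leNgt; apply/negP => Wj.
  have := imin j; rewrite kj Wj (leq_trans (ltnW ji) iN) => /(_ isT).
  by rewrite leqNgt ji.
apply: (@le_trans _ _ (\sum_(0 <= n <oo) (2%:E * mu (G n `&` U)))).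
  by apply: lee_nneseries => // n _.
rewrite nneseriesZl//.
rewrite lee_pmul2l ?lte_fin// -(measure_semi_bigcup mu mGU)//; last 2 first.
- by apply/trivIsetP => n1 n2 _ _ n12; rewrite setIACA (trivIsetP.1 tG)// set0I.
- exact: bigcupT_measurable.
apply: le_measure; rewrite ?inE//; first exact: bigcupT_measurable.
by move=> x [n _ []].
Qed.

(** Markov's inequality is applied to the exponential at the final time only, and the factor 2 comes
    from Levy's inequality. As [C] does not depend on the horizon [N], the horizon can tend to
    infinity. *)
Lemma expR_maximal_inequality (Y : T -> R) (k0 : nat) (a : R) (C : \bar R) :
  (0 < a)%R -> measurable_fun setT Y ->
  (forall (b : pred nat) x, (forall j, b j -> (k0 <= j)%N) -> Y (phi b x) = Y x) ->
  (forall N, (k0 <= N)%N -> \int[mu]_x (expR (a * (Y x + S N x)))%:E <= C) ->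
  mu [set x | exists n, (k0 <= n)%N /\ (0 < Y x + S n x)%R] <= 2%:E * C.
Proof.
move=> a0 mY hY hC.
have mW n : measurable_fun setT (fun x => Y x + S n x)%R.
  by apply: measurable_funD => //; exact: measurable_psum.
pose B N := [set x | exists n, (k0 <= n <= N)%N /\ (0 < Y x + S n x)%R].
have mB N : measurable (B N) by rewrite /B; mevent => //; exact: mW.
rewrite (_ : [set x | _] = \bigcup_N B N); last first.
  apply/seteqP; split=> x; first by move=> [n [kn h]]; exists n => //; exists n; rewrite kn leqnn.
  by move=> [N _ [n [/andP[kn _] h]]]; exists n.
have hcvg : mu (B N) @[N --> \oo] --> mu (\bigcup_N B N).
  apply: nondecreasing_cvg_mu => //; first exact: bigcupT_measurable.
  apply/nondecreasing_seqP => N; apply/subsetPset => x [n [/andP[kn nN] h]].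
  by exists n; rewrite kn leqW.
rewrite -(cvg_lim _ hcvg)//; apply: lime_le; first by apply/cvg_ex; eexists; exact: hcvg.
exists k0 => // N /= kN; apply: (le_trans (levy_inequality N mY hY)).
rewrite lee_pmul2l ?lte_fin//; apply: le_trans (hC N kN).
have mU : measurable [set x | (0 < Y x + S N x)%R] by apply: measurable_lt => //; exact: mW.
rewrite -(setIT [set x | _]) -integral_indic//.
apply: ge0_le_integral => //.
- by apply/measurable_EFinP; exact: measurable_indic.
- apply/measurable_EFinP; apply: measurableT_comp => //.
  by apply: measurable_funM => //; exact: mW.
move=> x _; rewrite lee_fin indicE; case: (boolP (x \in _)) => [|_]; last exact: expR_ge0.
by rewrite inE /= => h; rewrite -[X in (X <= _)%R]expR0 ler_expR mulr_ge0// ltW.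
Qed.

End SignSymmetric.

(** * Birth times along the Ulam-Harris tree *)

Section Words.
Context {R : realType}.

Fixpoint words (N L : nat) : seq (seq nat) :=
  [::] :: (if L is L'.+1 then [seq i :: w | i <- iota 0 N, w <- words N L'] else [::]).

Lemma mem_words N L w : (size w <= L)%N -> all (fun i => i < N)%N w -> w \in words N L.
Proof.
elim: L w => [|L IH] [|i w] //= sw /andP[iN aw]; rewrite inE/=.
apply/allpairsP; exists (i, w); split=> //=; first by rewrite mem_iota.
exact: IH.
Qed.

Variables (e : nat -> R) (m : R).
Hypothesis e_ge0 : forall i, (0 <= e i)%R.
Hypothesis m_lt1 : (m < 1)%R.
Hypothesis sum_e : forall N, (\sum_(i < N) e i <= m)%R.

Definition weight (w : seq nat) : R := (\prod_(i <- w) e i)%R.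

Lemma weight_ge0 w : (0 <= weight w)%R.
Proof. by rewrite /weight prodr_ge0. Qed.

(** The bound solves [z = 1 + m * z], the recursion obtained by splitting off the first letter of a
    word; it is the total mean progeny of a branching process with mean offspring [m]. *)
Lemma sum_words N L : (\sum_(w <- words N L) weight w <= (1 - m)^-1)%R.
Proof.
have m0 : (0 <= m)%R by have := sum_e 0; rewrite big_ord0.
have H : ((1 - m)^-1 = 1 + m * (1 - m)^-1)%R.
  by have := m_lt1; move=> ?; field; rewrite subr_eq0; apply/eqP; lra.
elim: L => [|L IH] /=.
  rewrite big_seq1 /weight big_nil H lerDl mulr_ge0// invr_ge0; have := m_lt1; lra.
rewrite big_cons {1}/weight big_nil H lerD2l big_allpairs_dep/=.
have -> : (\sum_(i <- iota 0 N) \sum_(w <- words N L) weight (i :: w) =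
    (\sum_(i < N) e i) * \sum_(w <- words N L) weight w)%R.
  rewrite mulr_suml -(big_mkord xpredT (fun i => e i * \sum_(w <- words N L) weight w)%R).
  rewrite /index_iota subn0; apply: eq_bigr => i _; rewrite mulr_sumr.
  by apply: eq_bigr => w _; rewrite /weight big_cons.
apply: ler_pM => //; first by rewrite sumr_ge0.
by rewrite sumr_ge0// => w _; exact: weight_ge0.
Qed.

Lemma sum_sub (T : eqType) (f : T -> R) (s t : seq T) : (forall x, 0 <= f x)%R ->
  uniq s -> {subset s <= t} -> (\sum_(x <- s) f x <= \sum_(x <- t) f x)%R.
Proof.
move=> f0; elim: s t => [|x s IH] t /=; first by rewrite big_nil sumr_ge0.
move=> /andP[xs us] st; have xt : x \in t by apply: st; rewrite inE eqxx.
rewrite big_cons (perm_big _ (perm_to_rem xt)) big_cons lerD2l; apply: IH => // y ys.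
have := st y; rewrite inE ys orbT => /(_ isT).
rewrite (perm_mem (perm_to_rem xt)) inE => /orP[/eqP yx|//].
by move: xs; rewrite -yx ys.
Qed.

Lemma sum_weight (ws : seq (seq nat)) : uniq ws ->
  (\sum_(w <- ws) weight w <= (1 - m)^-1)%R.
Proof.
move=> uws; pose L := (\max_(w <- ws) size w)%N.
pose N := (\max_(w <- ws) \max_(i <- w) i.+1)%N.
apply: le_trans (sum_words N L); apply: sum_sub => //; first exact: weight_ge0.
move=> w wws; apply: mem_words; first exact: leq_bigmax_seq wws isT.
apply/allP => i iw; have h1 : (i < \max_(i <- w) i.+1)%N.
  exact: (leq_bigmax_seq (F := succn) i iw isT).
exact: leq_trans h1 (leq_bigmax_seq (F := fun w => \max_(i <- w) i.+1)%N w wws isT).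
Qed.

(** The nodes are enumerated by [pickle_inv]; a number that encodes no node receives the empty
    event. *)
Lemma borel_cantelli_words d (T : measurableType d) (mu : probability T R)
    (E : seq nat -> set T) (C : R) : (0 <= C)%R ->
  (forall w, measurable (E w)) -> (forall w, mu (E w) <= (C * weight w)%:E) ->
  {ae mu, forall x, finite_set [set w | E w x]}.
Proof.
move=> C0 mE hE.
pose F n := if (pickle_inv n : option (seq nat)) is Some w then E w else set0.
have mF n : measurable (F n) by rewrite /F; case: (pickle_inv n).
have Foo : \sum_(n <oo) mu (F n) < +oo.
  apply: (@le_lt_trans _ _ (C * (1 - m)^-1)%:E); last exact: ltry.
  apply: lime_le; first exact: is_cvg_nneseries.
  apply: nearW => n.
  pose ws := pmap (@pickle_inv (seq nat)) (iota 0 n).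
  have uws : uniq ws.
    apply: (pmap_uniq (g := pickle)) (iota_uniq 0 n).
    by move=> k; rewrite pickle_invK.
  apply: (@le_trans _ _ (\sum_(w <- ws) (C * weight w)%:E)).
    rewrite /ws /index_iota subn0; elim: (iota 0 n) => [|k s IH] /=.
      by rewrite !big_nil.
    rewrite big_cons {1}/F; case: (pickle_inv k) => [w|] /=.
      by rewrite big_cons leeD.
    by rewrite measure0 add0e.
  by rewrite sumEFin lee_fin -mulr_sumr ler_wpM2l// sum_weight.
have h0 := lim_sup_set_cvg0 mF Foo.
have mL : measurable (lim_sup_set F).
  by apply: bigcap_measurable => // n _; exact: bigcup_measurable.
have := null_ae mL h0; apply: filterS => x nx.
have [N hN] : exists N, forall n, (N <= n)%N -> ~ F n x.
  apply: contrapT => h; apply: nx => N _; apply: contrapT => h'; apply: h; exists N.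
  by move=> n Nn Fn; apply: h'; exists n.
apply: (@sub_finite_set _ _ [set` pmap (@pickle_inv (seq nat)) (iota 0 N)]).
  move=> w /= Ew; rewrite mem_pmap; apply/mapP; exists (pickle w).
    rewrite mem_iota add0n/= ltnNge; apply/negP => /hN; apply.
    by rewrite /F pickleK_inv.
  by rewrite pickleK_inv.
exact: finite_seq.
Qed.

End Words.

(** * Exponential moments of waiting times *)

Section Laplace.
Context {R : realType}.
Variable nu : nat -> probability R R.

(** With this sign it is the moment generating function: the Laplace transform proper is its value
    at [- a], and its value at [a > 0] may be infinite. *)
Definition laplace (a : R) (j : nat) : \bar R := \int[nu j]_r (expR (a * r))%:E.

Lemma measurable_expR_scale (a : R) : measurable_fun setT (fun r : R => (expR (a * r))%:E).
Proof.
by apply/measurable_EFinP; apply: measurableT_comp => //; exact: measurable_funM.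
Qed.

Lemma laplace_ge0 a j : 0 <= laplace a j.
Proof. by apply: integral_ge0 => r _; rewrite lee_fin expR_ge0. Qed.

Lemma EFin_prod (J : Type) (s : seq J) (f : J -> R) :
  ((\prod_(i <- s) f i)%R)%:E = \prod_(i <- s) (f i)%:E.
Proof. by elim: s => [|i s IH]; rewrite ?big_nil// !big_cons EFinM IH. Qed.

Lemma integral_expR_sum (I : choiceType) (k : I -> nat) (mu : probability (config R I) R)
    (s : seq I) (a : I -> R) : product_law k nu mu -> uniq s ->
  \int[mu]_x (expR (\sum_(i <- s) a i * x i)%R)%:E = \prod_(i <- s) laplace (a i) (k i).
Proof.
move=> hmu us; rewrite -(@integral_prod_coord _ _ _ _ _ s (fun i r => (expR (a i * r))%:E) hmu us).
- by apply: eq_integral => x _; rewrite expR_sum EFin_prod.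
- by move=> i; exact: measurable_expR_scale.
- by move=> i r; rewrite lee_fin expR_ge0.
Qed.

End Laplace.

Section Births.
Context {R : realType}.
Local Notation I := (seq nat * nat)%type.

(** The coordinates added up on the way from [p] to [p ++ w]. As they are pairwise distinct, a birth
    time is a sum of independent variables. *)
Fixpoint path_idx (p w : seq nat) : seq I :=
  if w is i :: w' then [seq (p, j) | j <- iota 0 i.+1] ++ path_idx (rcons p i) w' else [::].

Definition rbirth (x : config R I) (w : seq nat) : R := (\sum_(i <- path_idx [::] w) x i)%R.

Lemma path_idx_cons p i w :
  path_idx p (i :: w) = [seq (p, j) | j <- iota 0 i.+1] ++ path_idx (rcons p i) w.
Proof. by []. Qed.

(** The depth of a row separates coordinates: it shows that a path never repeats one, and that a
    node's own row does not occur in its birth time. *)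
Lemma path_idx_size p w i : i \in path_idx p w -> (size p <= size i.1 < size p + size w)%N.
Proof.
elim: w p => [//|k w IH] p; rewrite path_idx_cons mem_cat => /orP[/mapP[j _ ->] /=|/IH].
  by rewrite leqnn/= addnS ltnS leq_addr.
by rewrite size_rcons addSnnS => /andP[h1 h2]; rewrite h2 andbT ltnW.
Qed.

Lemma path_idx_uniq p w : uniq (path_idx p w).
Proof.
elim: w p => [//|k w IH] p; rewrite path_idx_cons cat_uniq IH andbT map_inj_uniq; last first.
  by move=> j1 j2 [].
rewrite iota_uniq andTb.
apply/hasPn => i /path_idx_size; rewrite size_rcons => /andP[h _]; apply/negP => /mapP[j _ E].
by move: h; rewrite E/= ltnn.
Qed.

Lemma path_idx_rcons p w k :
  path_idx p (rcons w k) = path_idx p w ++ [seq (p ++ w, j) | j <- iota 0 k.+1].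
Proof.
elim: w p => [|i w IH] p; first by rewrite [LHS]/= !cats0.
by rewrite rcons_cons !path_idx_cons IH -catA cat_rcons.
Qed.

Lemma prod_path_idx (U : Type) (idx : U) (op : Monoid.law idx) (g : nat -> U) p w :
  \big[op/idx]_(i <- path_idx p w) g i.2 = \big[op/idx]_(i <- w) \big[op/idx]_(j < i.+1) g j.
Proof.
elim: w p => [|i w IH] p; first by rewrite !big_nil.
rewrite path_idx_cons big_cat big_cons IH; congr (op _ _).
by rewrite -(big_mkord xpredT g) /index_iota subn0 big_map.
Qed.

Lemma rbirth_rcons x w k : (rbirth x (rcons w k) = rbirth x w + \sum_(j < k.+1) x (w, j : nat))%R.
Proof.
rewrite /rbirth path_idx_rcons big_cat; congr (_ + _)%R.
by rewrite -(big_mkord xpredT (fun j => x (w, j))) /index_iota subn0 big_map.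
Qed.

Lemma birth_auxE (x : config R I) p w :
  birth_aux (fun u j => (x (u, j))%:E) p w = (\sum_(i <- path_idx p w) x i)%:E.
Proof.
elim: w p => [|i w IH] p; first by rewrite big_nil.
rewrite [LHS]/= IH sumEFin -EFinD; congr (_%:E).
rewrite path_idx_cons big_cat; congr (_ + _)%R.
by rewrite -(big_mkord xpredT (fun j => x (p, j))) /index_iota subn0 big_map.
Qed.

Lemma birthE (x : config R I) w : birth (fun u j => (x (u, j))%:E) w = (rbirth x w)%:E.
Proof. exact: birth_auxE. Qed.

Lemma measurable_rbirth w : measurable_fun setT (fun x : config R I => rbirth x w).
Proof.
by apply: measurable_sum => i; exact: measurable_coord.
Qed.

Variables (nu : nat -> probability R R) (mu : probability (config R I) R).
Hypothesis hmu : product_law snd nu mu.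
Local Notation laplace := (laplace nu).

Lemma integral_expR_birth (a : R) w :
  \int[mu]_x (expR (a * rbirth x w))%:E = \prod_(i <- w) \prod_(j < i.+1) laplace a j.
Proof.
rewrite -(prod_path_idx _ (laplace a) [::]) -(integral_expR_sum (fun=> a) hmu) ?path_idx_uniq//.
by apply: eq_integral => x _; rewrite /rbirth mulr_sumr.
Qed.

(** By Markov's inequality a node is born before time [n] with probability at most
    [expR (theta * n%:R)] times its weight, and the weights are summable. The selector [sel] covers
    both the tree of the first children of each node and the full tree. *)
Lemma locally_finite (theta m : R) (e : nat -> R) (sel : pred nat) : (0 < theta)%R ->
  (forall i, 0 <= e i)%R -> (m < 1)%R -> (forall N, \sum_(i < N) e i <= m)%R ->
  (forall i, sel i -> \prod_(j < i.+1) laplace (- theta) j <= (e i)%:E) ->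
  {ae mu, forall x, forall t : R, finite_set [set w | all sel w /\ (rbirth x w <= t)%R]}.
Proof.
move=> theta0 e0 m1 se he.
suff : {ae mu, forall x, forall n : nat, finite_set [set w | all sel w /\ (rbirth x w <= n%:R)%R]}.
  apply: filterS => x h t; apply: sub_finite_set (h (Num.bound t)) => w [aw wt]; split=> //.
  by rewrite (le_trans wt)// ltW// unstable.ltr_bound.
apply: ae_foralln => n.
have mE w : measurable [set x : config R I | all sel w /\ (rbirth x w <= n%:R)%R].
  by mevent => //; exact: measurable_rbirth.
apply: (borel_cantelli_words e0 m1 se
  (E := fun w => [set x : config R I | all sel w /\ (rbirth x w <= n%:R)%R])
  (expR_ge0 (theta * n%:R)) mE) => w.
 have [aw|naw] := pselect (all sel w); last first.
  rewrite (_ : [set x | _] = set0) ?measure0 ?lee_fin ?mulr_ge0 ?expR_ge0 ?weight_ge0//.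
  by apply/seteqP; split=> // x [/naw].
apply: (@le_trans _ _ ((expR (theta * n%:R))%:E * \int[mu]_x (expR (- theta * rbirth x w))%:E)).
  have mX : measurable_fun setT (fun x : config R I => (expR (- theta * rbirth x w))%:E).
    apply/measurable_EFinP; apply: measurableT_comp => //.
    by apply: measurable_funM => //; exact: measurable_rbirth.
  rewrite -ge0_integralZl//.
  rewrite -(setIT [set x | _]) -integral_indic//.
  apply: ge0_le_integral => //.
  - by apply/measurable_EFinP; exact: measurable_indic.
  - exact: measurable_funeM.
  move=> x _; rewrite -EFinM -expRD lee_fin indicE.
  case: (boolP (x \in _)) => [|_]; last exact: expR_ge0.
  rewrite inE /= => -[_ h]; rewrite -[X in (X <= _)%R]expR0 ler_expR.
  have := ler_wpM2l (ltW theta0) h; lra.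
rewrite integral_expR_birth EFinM lee_pmul2l ?lte_fin ?expR_gt0// /weight EFin_prod.
elim: w aw {mE} => [|i w IH]; first by rewrite !big_nil.
move=> /= /andP[si aw]; rewrite !big_cons; apply: lee_pmul => //; last exact: IH.
- by apply: prode_ge0 => j _; exact: laplace_ge0.
- by apply: prode_ge0 => k _; apply: prode_ge0 => j _; exact: laplace_ge0.
- exact: he.
Qed.

(** * Exchanging the waiting times of two nodes *)

Section Rows.
Variables u v : seq nat.
Hypothesis uv : u != v.

Definition flip (a : pred nat) (i : I) : I :=
  if a i.2 then (if i.1 == u then v else if i.1 == v then u else i.1, i.2) else i.

Lemma flip_inj a : injective (flip a).
Proof.
apply: (can_inj (g := flip a)) => -[w j]; rewrite /flip/=; case aj: (a j) => /=; rewrite aj//.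
by case: (eqVneq w u) => [->|wu]; [rewrite eqxx eq_sym (negbTE uv)|
  case: (eqVneq w v) => [->|wv]; [rewrite eqxx|rewrite (negbTE wu) (negbTE wv)]].
Qed.

Lemma flip_snd a i : (flip a i).2 = i.2.
Proof. by rewrite /flip; case: ifP. Qed.

Definition phi a : config R I -> config R I := relabel (flip a).

Lemma phi_inv a A : measurable A -> mu (phi a @^-1` A) = mu A.
Proof.
move=> mA.
exact: (product_law_unique (product_law_relabel (@flip_inj a) (flip_snd a) hmu) hmu mA).
Qed.

Definition gap j (x : config R I) : R := (x (u, j) - x (v, j))%R.

Lemma measurable_gap j : measurable_fun setT (gap j).
Proof. by apply: measurable_funB; exact: measurable_coord. Qed.

Lemma gap_phi a j x : gap j (phi a x) = (if a j then - gap j x else gap j x)%R.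
Proof.
rewrite /gap /phi /relabel /flip/=; case: ifP => // _.
by rewrite !eqxx eq_sym (negbTE uv) opprB.
Qed.

End Rows.

End Births.

(** * Trees, degrees and hubs of a fixed configuration *)

Section Counting.
Context {R : realType} {T : choiceType}.
Local Notation cnt := (@counting T R).

Lemma counting_ge (A : set T) (s : seq T) : uniq s -> (forall y, y \in s -> A y) ->
  (size s)%:R%:E <= cnt A.
Proof.
move=> us sA; rewrite /counting; case: asboolP => fA; last exact: leey.
rewrite lee_fin ler_nat; apply: uniq_leq_size => // y ys.
by rewrite in_fset_set// inE; exact: sA.
Qed.

Lemma counting_le_seq (A : set T) (s : seq T) : (forall y, A y -> y \in s) ->
  cnt A <= (size s)%:R%:E.
Proof.
move=> As; have fA : finite_set A.
  by apply: sub_finite_set (finite_seq s) => y /As.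
rewrite /counting asboolT// lee_fin ler_nat; apply: uniq_leq_size; first exact: finmap.fset_uniq.
by move=> y; rewrite in_fset_set// inE => /As.
Qed.

Lemma counting_le (A B : set T) : A `<=` B -> cnt A <= cnt B.
Proof.
move=> AB; rewrite {2}/counting; case: asboolP => fB; last exact: leey.
by apply: counting_le_seq => y /AB yB; rewrite in_fset_set// inE.
Qed.

Lemma counting_lt_finite (A : set T) (n : nat) : cnt A < n%:R%:E -> finite_set A.
Proof. by rewrite /counting; case: asboolP. Qed.

Lemma counting_finite (A : set T) : finite_set A ->
  exists2 s : seq T, uniq s & (forall y, y \in s <-> A y) /\ cnt A = (size s)%:R%:E.
Proof.
move=> fA; exists (finmap.enum_fset (fset_set A)); first exact: finmap.fset_uniq.
split; first by move=> y; rewrite in_fset_set// inE.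
by rewrite /counting asboolT.
Qed.

Lemma counting_eq (A B : set T) : finite_set B -> A `<=` B -> cnt B <= cnt A -> A = B.
Proof.
move=> fB AB BA; apply/seteqP; split=> // y By.
have [s us [hs cs]] := counting_finite (sub_finite_set AB fB).
apply: contrapT => nAy.
have : (size (y :: s))%:R%:E <= cnt B.
  apply: counting_ge; first by rewrite /= us andbT; apply/negP => /hs.
  by move=> z; rewrite inE => /orP[/eqP ->//|/hs/AB].
by move=> /le_trans/(_ BA); rewrite cs lee_fin ler_nat /= ltnn.
Qed.

End Counting.

Section Trees.
Context {R : realType}.
Local Notation I := (seq nat * nat)%type.
Variable x : config R I.
Hypothesis x0 : forall i, (0 <= x i)%R.
Local Notation b := (rbirth x).
Local Notation X := (fun (u : seq nat) (j : nat) => (x (u, j))%:E).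

Lemma rbirth_nil : b [::] = 0%R.
Proof. by rewrite /rbirth big_nil. Qed.

Lemma rbirth_parent w k : (b w <= b (rcons w k))%R.
Proof. by rewrite rbirth_rcons lerDl sumr_ge0. Qed.

Lemma rbirth_child_le w k k' : (k <= k')%N -> (b (rcons w k) <= b (rcons w k'))%R.
Proof.
move=> kk'; rewrite !rbirth_rcons lerD2l.
rewrite -!(big_mkord xpredT (fun j => x (w, j))).
by rewrite [X in (_ <= X)%R](big_cat_nat _ (n := k.+1))//= lerDl sumr_ge0.
Qed.

Lemma rbirth_ge0 w : (0 <= b w)%R.
Proof. by rewrite /rbirth sumr_ge0. Qed.

Lemma rbirth_head i w : (b [:: i] <= b (i :: w))%R.
Proof.
elim/last_ind: w => [//|w k IH]; apply: (le_trans IH).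
by rewrite -rcons_cons rbirth_parent.
Qed.

Definition rtree (t : R) : set (seq nat) := [set w | (b w <= t)%R].

Lemma cmj_treeE (t : R) : cmj_tree X t%:E = rtree t.
Proof. by apply/seteqP; split=> w; rewrite /cmj_tree /rtree /= birthE lee_fin. Qed.

Lemma rtree_le s t : (s <= t)%R -> rtree s `<=` rtree t.
Proof. by move=> st w; rewrite /rtree /= => /le_trans; apply. Qed.

Local Notation cnt := (@counting _ R).

(** Siblings are born in order, so having [k.+1] children means that the child with index [k] is
    born. All comparisons of degrees thereby become comparisons of birth times. *)
Lemma outdeg_ge t u k : (k.+1%:R%:E <= outdeg (R := R) (rtree t) u) <-> rtree t (rcons u k).
Proof.
rewrite /outdeg; split; last first.
  move=> hk; rewrite asboolT; last exact: le_trans (rbirth_parent u k) hk.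
  rewrite -[in X in X%:R](size_iota 0 k.+1); apply: counting_ge; first exact: iota_uniq.
  move=> j; rewrite mem_iota add0n ltnS => /andP[_ jk].
  exact: le_trans (rbirth_child_le u jk) hk.
case: asboolP => // ut; apply: contraPP => hk; apply/negP; rewrite -ltNge.
apply: (@le_lt_trans _ _ k%:R%:E); last by rewrite lte_fin ltr_nat.
rewrite -[in X in _ <= X%:R%:E](size_iota 0 k); apply: counting_le_seq => j /= hj.
rewrite mem_iota add0n/= ltnNge; apply/negP => kj; apply: hk.
exact: le_trans (rbirth_child_le u kj) hj.
Qed.

(** The next node to be born is a child of a living node. Each of the finitely many living nodes has
    at most one first unborn child, and it lies at a positive distance in time, even if infinitely
    many siblings follow it. *)
Lemma rtree_right_open t : (0 <= t)%R -> finite_set (rtree t) ->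
  exists2 e : R, (0 < e)%R & rtree (t + e) = rtree t.
Proof.
move=> t0 /finite_seqP[s hs].
pose ok w (e : R) := forall k, (b (rcons w k) <= t + e)%R -> (b (rcons w k) <= t)%R.
have [e e0 he] : exists2 e : R, (0 < e)%R & forall w, w \in s -> ok w e.
  elim: s {hs} => [|w s [e e0 he]]; first by exists 1%R.
  have [d d0 hd] : exists2 d : R, (0 < d)%R & ok w d.
    have [[k hk]|nk] := pselect (exists k, (t < b (rcons w k))%R); last first.
      by exists 1%R => // k _; rewrite leNgt; apply/negP => h; apply: nk; exists k.
    have [k' hk' kmin] := @ex_minnP (fun k => (t < b (rcons w k))%R) (ex_intro _ k hk).
    exists ((b (rcons w k') - t) / 2)%R; first by rewrite divr_gt0// subr_gt0.
    move=> j hj; rewrite leNgt; apply/negP => /kmin /(rbirth_child_le w) h.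
    by move: hj h hk'; lra.
  exists (Num.min d e); first by rewrite lt_min d0 e0.
  move=> w'; rewrite inE => /orP[/eqP ->|ws] k hk.
    by apply: hd; rewrite (le_trans hk)// lerD2l ge_min lexx.
  by apply: (he w' ws); rewrite (le_trans hk)// lerD2l ge_min lexx orbT.
exists e => //; apply/seteqP; split; last by apply: rtree_le; rewrite lerDl ltW.
move=> w; elim/last_ind: w => [_|w k IH hw]; first by rewrite /rtree /= rbirth_nil.
have : rtree t w by apply: IH; exact: le_trans (rbirth_parent w k) hw.
move=> ht; have ws : w \in s by move: ht; rewrite hs.
exact: (he w ws k hw).
Qed.

Definition rtau n : R := fine (cmj_tau X n).

Lemma cmj_tau_ge0 n : 0 <= cmj_tau X n.
Proof. by apply: le_ereal_inf_tmp => t []. Qed.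

Lemma cmj_tau_le n (t : R) : (0 <= t)%R -> n%:R%:E <= cnt (rtree t) -> cmj_tau X n <= t%:E.
Proof. by move=> t0 ht; apply: ereal_inf_lbound; split; rewrite ?lee_fin// cmj_treeE. Qed.

Lemma cmj_tauE n : cmj_tau X n = (rtau n)%:E.
Proof.
rewrite /rtau fineK// ge0_fin_numE ?cmj_tau_ge0//.
(* The [n] children of the root with indices below [n] are all born by the birth time of the child
   with index [n]. *)
apply: (@le_lt_trans _ _ (b [:: n])%:E); last exact: ltry.
apply: cmj_tau_le; first exact: rbirth_ge0.
rewrite -[in X in X%:R](size_iota 0 n) -(size_map (fun j => [:: j])).
apply: counting_ge; first by rewrite map_inj_uniq ?iota_uniq// => i j [].
move=> w /mapP[j]; rewrite mem_iota add0n => /andP[_ jn] ->.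
exact: (rbirth_child_le [::] (ltnW jn)).
Qed.

Lemma rtau_ge0 n : (0 <= rtau n)%R.
Proof. by rewrite -lee_fin -cmj_tauE; exact: cmj_tau_ge0. Qed.

Lemma cmj_seqE n : cmj_seq X n = rtree (rtau n).
Proof. by rewrite /cmj_seq cmj_tauE cmj_treeE. Qed.

Lemma rtau_le n (t : R) : (0 <= t)%R -> n%:R%:E <= cnt (rtree t) -> (rtau n <= t)%R.
Proof. by move=> t0 ht; rewrite -lee_fin -cmj_tauE; exact: cmj_tau_le. Qed.

(** The infimum is attained: with fewer than [n] nodes at time [rtau n] the tree would be finite and
    constant for a short while, which would make the infimum larger. *)
Lemma count_rtau n : n%:R%:E <= cnt (rtree (rtau n)).
Proof.
rewrite leNgt; apply/negP => h.
have [e e0 he] := rtree_right_open (rtau_ge0 n) (counting_lt_finite h).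
have : (rtau n + e)%:E <= cmj_tau X n.
  apply: le_ereal_inf_tmp => t [t0 ht]; rewrite leNgt; apply/negP => hlt.
  move: t0 ht hlt; case: t => [t| |]//; rewrite lee_fin cmj_treeE lte_fin => t0 ht hlt.
  have := le_trans ht (counting_le (R := R) (rtree_le (ltW hlt))).
  by rewrite he leNgt h.
by rewrite cmj_tauE lee_fin; lra.
Qed.

Lemma count_rtree_lt n (t : R) : (0 <= t)%R -> (t < rtau n)%R -> cnt (rtree t) < n%:R%:E.
Proof. by move=> t0 h; rewrite ltNge; apply/negP => /(rtau_le t0); rewrite leNgt h. Qed.

Lemma hub_dominates u : persistent_hub (R := R) (cmj_seq X) u -> exists N, forall n v k,
  (N <= n)%N -> rtree (rtau n) (rcons v k) -> rtree (rtau n) (rcons u k).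
Proof.
move=> [_ [N hN]]; exists N => n v k Nn hv.
apply/outdeg_ge; have := hN n Nn; rewrite cmj_seqE => ->.
apply: (le_trans ((outdeg_ge _ _ _).2 hv)); apply: ereal_sup_ubound; exists v => //.
exact: le_trans (rbirth_parent v k) hv.
Qed.

(** From some index on, a hub has each child no later than [v] has the child with the same index, so
    [b v - b u] bounds the late gaps. The difficulty is that dominance is known along [rtau n] and
    not at every time. *)
Lemma hub_gap_bounded u v :
  (forall (m : nat) (t : R), finite_set [set w | all (fun i => i < m)%N w /\ (b w <= t)%R]) ->
  persistent_hub (R := R) (cmj_seq X) u ->
  exists c : R, forall k, (psum (gap u v) k x <= c)%R.
Proof.
move=> hfin /hub_dominates[N hN].
(* If [u] never got its child [m], no node would from [N] on, the root included. All these trees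
   would lie in one finite set, namely the nodes with letters below [m] born by the time [b [:: m]],
   although their sizes grow without bound. *)
have step1 m : exists n, rtree (rtau n) (rcons u m).
  apply: contrapT => /forallNP hm.
  have small n w : (N <= n)%N -> rtree (rtau n) w -> all (fun i => i < m)%N w.
    move=> Nn; elim/last_ind: w => [//|w k IH] hw; rewrite all_rcons IH ?andbT; last first.
      exact: le_trans (rbirth_parent w k) hw.
    rewrite ltnNge; apply/negP => mk; apply: (hm n).
    exact: le_trans (rbirth_child_le u mk) (hN n w k Nn hw).
  have [s _ [hs cs]] := counting_finite (R := R) (hfin m (b [:: m])).
  pose n := maxn N (size s).+1.
  have Nn : (N <= n)%N by exact: leq_maxl.
  have tn : (rtau n < b [:: m])%R.
    rewrite ltNge; apply/negP => h; apply: (hm n).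
    by apply: (hN n [::] m Nn).
  have := le_trans (count_rtau n) (counting_le_seq (R := R) (A := rtree (rtau n)) (s := s) _).
  rewrite lee_fin ler_nat leqNgt leq_maxr => h.
  suff : false by [].
  apply: h => w hw; apply/hs; split; first exact: small hw.
  exact: ltW (le_lt_trans hw tn).
have psumE k : (psum (gap u v) k.+1 x = b (rcons u k) - b u - b (rcons v k) + b v)%R.
  by rewrite /psum !rbirth_rcons sumrB; ring.
(* If [u] has all its children by a finite time, [rtau] may stay bounded; but then the row of [u]
   has a finite sum and the gap is bounded because the row of [v] is nonnegative. *)
have [[c hc]|hunb] := pselect (exists c, forall k, b (rcons u k) <= c)%R.
  exists (`|c| + `|b v|)%R => -[|k].
    by rewrite /psum big_ord0 addr_ge0.
  rewrite psumE; have := hc k; have := rbirth_ge0 u; have := rbirth_parent v k.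
  have := ler_norm c; have := normr_ge0 (b v); have := rbirth_ge0 v; lra.
have unb t : exists n, (t < rtau n)%R.
  have [k hk] : exists k, (t < b (rcons u k))%R.
    apply: contrapT => /forallNP h; apply: hunb; exists t => k.
    by rewrite leNgt; apply/negP; exact: h.
  by have [n hn] := step1 k; exists n; exact: lt_le_trans hk hn.
have key k : (N <= k)%N -> (b (rcons u k) <= b (rcons v k))%R.
  move=> Nk; set t := b (rcons v k).
  have t0 : (0 <= t)%R by exact: rbirth_ge0.
  have [n0 hn0] := unb t.
  have ft : finite_set (rtree t) := counting_lt_finite (count_rtree_lt t0 hn0).
  (* Simultaneous births make several indices share a tree; the number of nodes alive at [t] is an
     index whose tree is exactly the one at [t]. It is at least [N] since [v] already has [k.+1]
     children. *)
  have [s us [hs cs]] := counting_finite (R := R) ft.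
  have Ns : (N <= size s)%N.
    apply: (leq_trans Nk); apply: ltnW.
    rewrite -(@ler_nat R) -lee_fin -cs -[in X in X%:R](size_iota 0 k.+1).
    rewrite -(size_map (fun j => rcons v j)).
    apply: counting_ge.
      by rewrite map_inj_uniq ?iota_uniq// => i j /rcons_inj[].
    move=> w /mapP[j]; rewrite mem_iota add0n ltnS => /andP[_ jk] ->.
    exact: rbirth_child_le.
  have E : rtree (rtau (size s)) = rtree t.
    apply: (counting_eq (R := R) ft).
      by apply: rtree_le; apply: rtau_le => //; rewrite cs.
    by rewrite cs; exact: count_rtau.
  have := hN (size s) v k Ns; rewrite E; apply; exact: lexx.
apply: (@eventually_le_bounded _ _ N.+1 (b v - b u)%R) => -[//|k] Nk.
by rewrite psumE; have := key k Nk; lra.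
Qed.

(** Nodes outside [s] never overtake the root, so the hub is sought among the root and [s]: eventual
    order of pairs gives a finite list an eventually earliest member. *)
Lemma hub_exists (s : seq (seq nat)) : (forall t : R, finite_set (rtree t)) ->
  (forall i w n, i :: w \notin s -> (i < n)%N -> (b [:: n] <= b (rcons (i :: w) n))%R) ->
  (forall u v, u != v -> (exists N, forall n, (N <= n)%N -> (b (rcons u n) <= b (rcons v n))%R) \/
    (exists N, forall n, (N <= n)%N -> (b (rcons v n) <= b (rcons u n))%R)) ->
  has_persistent_hub (R := R) (cmj_seq X).
Proof.
move=> fin hs pair.
have [h hh] : exists h, forall v, v \in [::] :: s ->
    exists N, forall n, (N <= n)%N -> (b (rcons h n) <= b (rcons v n))%R.
  elim: ([::] :: s) => [|u t [h IH]]; first by exists [::].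
  have [/eqP uh|uh] := boolP (u == h).
    exists h => v; rewrite inE => /orP[/eqP ->|]; last exact: IH.
    by exists 0%N => n _; rewrite uh.
  case: (pair u h uh) => -[N hN].
    exists u => v; rewrite inE => /orP[/eqP ->|]; first by exists 0%N.
    move=> /IH[N' hN']; exists (maxn N N') => n; rewrite geq_max => /andP[h1 h2].
    exact: le_trans (hN n h1) (hN' n h2).
  exists h => v; rewrite inE => /orP[/eqP ->|]; last exact: IH.
  by exists N.
have [N hN] : exists N, forall v n, v \in [::] :: s -> (N <= n)%N ->
    (b (rcons h n) <= b (rcons v n))%R.
  elim: ([::] :: s) hh => [|u t IH] hh; first by exists 0%N.
  have [v vt|N hN] := IH; first by apply: hh; rewrite inE vt orbT.
  have [|N' hN'] := hh u; first by rewrite inE eqxx.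
  exists (maxn N N') => v n; rewrite inE geq_max => /orP[/eqP ->|vt] /andP[h1 h2].
    exact: hN'.
  exact: hN.
(* From [M] on, [h] already has its children up to index [N], so only later children remain to be
   compared. *)
have [M hM] : exists M, forall n, (M <= n)%N -> (b (rcons h N) <= rtau n)%R.
  have t0 : (0 <= b (rcons h N))%R by exact: rbirth_ge0.
  have [s' _ [_ cs]] := counting_finite (R := R) (fin (b (rcons h N))).
  exists (size s').+1 => n hn; rewrite leNgt; apply/negP => hlt.
  have := le_trans (count_rtau n) (counting_le (R := R) (rtree_le (ltW hlt))).
  by rewrite cs lee_fin ler_nat leqNgt hn.
have dom n v k : (M <= n)%N -> rtree (rtau n) (rcons v k) -> rtree (rtau n) (rcons h k).
  move=> Mn.
  have domS v' : v' \in [::] :: s -> rtree (rtau n) (rcons v' k) -> rtree (rtau n) (rcons h k).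
    move=> vs hv; have [kN|Nk] := leqP k N.
      exact: le_trans (rbirth_child_le h kN) (hM n Mn).
    exact: le_trans (hN v' k vs (ltnW Nk)) hv.
  have [vs|] := boolP (v \in [::] :: s); first exact: domS.
  case: v => [|i w]; first by rewrite inE eqxx.
  rewrite inE/= => ns hv; apply: (domS [::]); first by rewrite inE eqxx.
  (* For [k <= i] the root had its child [k] before its child [i], an ancestor of the node or the
     node itself; beyond [i] the assumption on nodes outside [s] applies. *)
  rewrite /=; have [ki|ik] := leqP k i.
    apply: le_trans (rbirth_child_le [::] ki) _; apply: le_trans (rbirth_head i w) _.
    exact: le_trans (rbirth_parent (i :: w) k) hv.
  exact: le_trans (hs i w k ns ik) hv.
have hT n : (M <= n)%N -> rtree (rtau n) h.
  by move=> Mn; exact: le_trans (rbirth_parent h N) (hM n Mn).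
exists h; split; first by exists M; rewrite cmj_seqE; exact: hT.
exists M => n Mn; rewrite cmj_seqE; apply/eqP; rewrite eq_le; apply/andP; split.
  by apply: ereal_sup_ubound; exists h => //; exact: hT.
apply: ge_ereal_sup => _ [v hv <-]; rewrite /outdeg !asboolT//; last exact: hT.
by apply: counting_le => k; exact: dom.
Qed.

End Trees.

(** * Absence of a hub *)

Lemma ae_forall_count d (T : measurableType d) (R : realType) (mu : probability T R)
    (J : countType) (Q : J -> T -> Prop) :
  (forall j, {ae mu, forall x, Q j x}) -> {ae mu, forall x j, Q j x}.
Proof.
move=> h; have : {ae mu, forall x n, if (@unpickle J n) is Some j then Q j x else True}.
  apply: ae_foralln => n; case: (@unpickle J n) => [j|]; first exact: h.
  exact: aeW.
by apply: filterS => x hx j; have := hx (pickle j); rewrite pickleK.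
Qed.

Section NonnegativeLaws.
Context {R : realType}.
Variable nu : nat -> probability R R.
Hypothesis nu_pos : forall j, nu j [set r | (r < 0)%R] = 0.

Lemma measurable_negatives : measurable [set r : R | (r < 0)%R].
Proof. exact: (@measurable_lt _ _ R id (cst 0%R)). Qed.

Lemma nu_ae_ge0 j : {ae nu j, forall r, (0 <= r)%R}.
Proof.
have := null_ae measurable_negatives (nu_pos j).
by apply: filterS => r /= /negP; rewrite -leNgt.
Qed.

Lemma laplace_le1 (theta : R) j : (0 <= theta)%R -> laplace nu (- theta) j <= 1.
Proof.
move=> t0; rewrite /laplace.
rewrite (_ : 1 = \int[nu j]_r (cst 1) r); last first.
  by rewrite integral_cst// mul1e; exact/esym/probability_setT.
apply: ae_ge0_le_integral => //.
- exact: measurable_expR_scale.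
- have := nu_ae_ge0 j; apply: filterS => r r0 _.
  by rewrite lee_fin -[leRHS]expR0 ler_expR mulNr oppr_le0 mulr_ge0.
Qed.

Lemma laplace_fin (theta : R) j : (0 <= theta)%R ->
  laplace nu (- theta) j = (fine (laplace nu (- theta) j))%:E.
Proof.
move=> t0; rewrite fineK// ge0_fin_numE ?laplace_ge0//.
by rewrite (le_lt_trans (laplace_le1 j t0))// ltry.
Qed.

(** Dominated convergence: on nonnegative reals the exponentials decrease to the indicator of
    zero. *)
Lemma laplace_cvg j : laplace nu (- n%:R) j @[n --> \oo] --> nu j [set 0%R].
Proof.
pose f_ (n : nat) (r : R) := (expR (- n%:R * r))%:E.
pose f (r : R) := (\1_[set 0%R] r)%:E : \bar R.
have mf_ n : measurable_fun setT (f_ n) by exact: measurable_expR_scale.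
have mf : measurable_fun setT f.
  by apply/measurable_EFinP; apply: measurable_indic; exact: measurable_set1.
have h1 : {ae nu j, forall r, [set: R] r -> f_ n r @[n --> \oo] --> f r}.
  have := nu_ae_ge0 j; apply: filterS => r r0 _.
  apply/fine_cvgP; split; first exact: nearW.
  rewrite indicE; have [->|rn0] := eqVneq r 0%R.
    rewrite mem_set// mulr1n; apply: cvg_near_cst; apply: nearW => n /=.
    by rewrite mulr0 expR0.
  rewrite memNset; last by move=> /= /eqP; rewrite (negbTE rn0).
  have rp : (0 < r)%R by rewrite lt_neqAle eq_sym rn0.
  have E : (fine \o f_ ^~ r) = (fun n => expR (- r) ^+ n)%R.
    by apply/funext => n /=; rewrite -expRM_natl; congr expR; ring.
  rewrite E; apply: cvg_expr; rewrite ger0_norm ?expR_ge0//.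
  by rewrite -expR0 ltr_expR oppr_lt0.
have h2 : (nu j).-integrable setT (cst 1%:E : R -> \bar R).
  exact: finite_measure_integrable_cst.
have h3 : {ae nu j, forall r n, [set: R] r -> `|f_ n r| <= cst 1%:E r}.
  have := nu_ae_ge0 j; apply: filterS => r r0 n _.
  rewrite gee0_abs ?lee_fin ?expR_ge0//.
  by rewrite -[leRHS]expR0 ler_expR mulNr oppr_le0 mulr_ge0.
have [_ _] := dominated_convergence measurableT mf_ mf h1 h2 h3.
by rewrite integral_indic ?setIT.
Qed.

(** With [m] children the sum is finite, so the limit of large [theta] can be taken termwise; it is
    a partial sum of the series assumed to be less than 1. *)
Lemma truncated_subcritical (m : nat) :
  \sum_(0 <= j <oo) \prod_(i < j.+1) nu i [set 0%R] < 1 ->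
  exists2 theta : R, (0 < theta)%R &
    (\sum_(i < m) \prod_(j < i.+1) fine (laplace nu (- theta) j) < 1)%R.
Proof.
move=> h.
pose g n i := (\prod_(j < i) fine (laplace nu (- n%:R) j))%R.
have q0 j : 0 <= nu j [set 0%R] by exact: measure_ge0.
have qE j : nu j [set 0%R] = (fine (nu j [set 0%R]))%:E.
  by rewrite fineK// fin_num_measure.
have gcvg i : g n i @[n --> \oo] --> (\prod_(j < i) fine (nu j [set 0%R]))%R.
  elim: i => [|i IH]; rewrite /g.
    by under eq_fun do rewrite big_ord0; rewrite big_ord0; exact: cvg_cst.
  under eq_fun do rewrite big_ord_recr/=; rewrite big_ord_recr/=.
  apply: cvgM => //; have := @laplace_cvg i; rewrite qE => /fine_cvgP[_ h1].
  exact: h1.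
have scvg k : (\sum_(i < k) g n i.+1)%R @[n --> \oo] -->
    (\sum_(i < k) \prod_(j < i.+1) fine (nu j [set 0%R]))%R.
  elim: k => [|k IH].
    by under eq_fun do rewrite big_ord0; rewrite big_ord0; exact: cvg_cst.
  under eq_fun do rewrite big_ord_recr/=; rewrite big_ord_recr/=.
  by apply: cvgD => //; exact: gcvg.
have s1 : (\sum_(i < m) \prod_(j < i.+1) fine (nu j [set 0%R]) < 1)%R.
  rewrite -lte_fin; apply: le_lt_trans h.
  apply: le_trans (@nneseries_lim_ge _ _ xpredT 0%N m _); last first.
    by move=> n _ _; apply: prode_ge0.
  rewrite big_mkord -sumEFin; apply: lee_sum => i _.
  rewrite EFin_prod; rewrite le_eqVlt; apply/orP; left; apply/eqP.
  by apply: eq_bigr => j _; rewrite -qE.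
have [N _ hN] := cvgr_lt _ (scvg m) _ s1.
by exists (N.+1%:R)%R => //; exact: (hN N.+1 (leqnSn N)).
Qed.

Local Notation I := (seq nat * nat)%type.
Variable mu : probability (config R I) R.
Hypothesis hmu : product_law snd nu mu.

Lemma ae_nonneg : {ae mu, forall x i, (0 <= x i)%R}.
Proof.
apply: ae_forall_count => i.
have m0 : mu [set x | (x i < 0)%R] = 0.
  have := hmu (s := [:: i]) (B := fun=> [set r | (r < 0)%R]) isT.
  rewrite big_seq1 nu_pos => <-.
    congr (mu _); apply/seteqP; split=> x h; first by move=> j; rewrite inE => /eqP ->.
    by apply: h; rewrite inE.
  by move=> _; exact: measurable_negatives.
have mi : measurable [set x : config R I | (x i < 0)%R].
  by apply: measurable_lt => //; exact: measurable_coord.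
have := null_ae mi m0.
by apply: filterS => x /= /negP; rewrite -leNgt.
Qed.

Lemma ae_truncated_locally_finite :
  \sum_(0 <= j <oo) \prod_(i < j.+1) nu i [set 0%R] < 1 ->
  {ae mu, forall x (m : nat) (t : R),
    finite_set [set w | all (fun i => i < m)%N w /\ (rbirth x w <= t)%R]}.
Proof.
move=> h; apply: ae_foralln => m.
have [theta t0 ht] := truncated_subcritical m h.
pose g i := (\prod_(j < i.+1) fine (laplace nu (- theta) j))%R.
have g0 i : (0 <= g i)%R by apply: prodr_ge0 => j _; apply: fine_ge0; exact: laplace_ge0.
apply: (@locally_finite _ _ _ hmu theta (\sum_(i < m) g i)%R
  (fun i => if (i < m)%N then g i else 0%R)) => //.
- by move=> i; case: ifP.
- move=> N; rewrite -(big_mkord xpredT (fun i => if (i < m)%N then g i else 0%R)).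
  rewrite -big_mkcond/= -(big_mkord xpredT g) -big_filter.
  apply: sum_sub => //; first by rewrite filter_uniq ?iota_uniq.
  by move=> i; rewrite mem_filter !mem_index_iota => /andP[].
- move=> i im; rewrite im /g EFin_prod le_eqVlt; apply/orP; left; apply/eqP.
  by apply: eq_bigr => j _; rewrite -laplace_fin// ltW.
Qed.

Lemma no_hub : \sum_(0 <= j <oo) \prod_(i < j.+1) nu i [set 0%R] < 1 ->
  (forall u v, u != v -> {ae mu, forall x, ~ cvgn (psum (gap u v) ^~ x)}) ->
  {ae mu, forall x, ~ has_persistent_hub (R := R) (cmj_seq (fun u j => (x (u, j))%:E))}.
Proof.
move=> h hdiv.
(* Comparison with a single other node is enough: the root, or the root's first child if [u] is the
   root. *)
pose o (u : seq nat) : seq nat := if u == [::] then [:: 0%N] else [::].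
have uo u : u != o u by rewrite /o; case: ifPn => // /eqP ->.
have h1 : {ae mu, forall x u, ~ exists c : R, forall k, (psum (gap u (o u)) k x <= c)%R}.
  apply: ae_forall_count => u.
  have := bounded_above_cvg (measurable_gap u (o u)) (fun a => measurable_relabel (flip u (o u) a))
    (phi_inv hmu (uo u)) (gap_phi (uo u)).
  by apply: filterS2 (hdiv _ _ (uo u)) => x nc hc /hc.
apply: filterS3 h1 ae_nonneg (ae_truncated_locally_finite h) => x nb x0 hfin [u hu].
exact: nb (hub_gap_bounded x0 (o u) hfin hu).
Qed.

End NonnegativeLaws.

(** * Existence of a hub *)

Section Persistence.
Context {R : realType}.
Local Notation I := (seq nat * nat)%type.
Variable nu : nat -> probability R R.
Hypothesis nu_pos : forall j, nu j [set r | (r < 0)%R] = 0.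
Variable mu : probability (config R I) R.
Hypothesis hmu : product_law snd nu mu.
Local Notation L := (laplace nu).

(** The coordinates in [s0] avoid row [u] and the columns of row [v] from [k0] on, so every
    coordinate carries exactly one exponent. With [s0] empty this compares two rows; otherwise [s0]
    holds what remains of a birth time. *)
Lemma integral_rows (a c : R) u v (s0 : seq I) k0 N : u != v -> uniq s0 ->
  (forall i, i \in s0 -> i.1 != u) -> (forall j, (k0 <= j)%N -> (v, j) \notin s0) ->
  \int[mu]_x (expR (a * (c - \sum_(i <- s0) x i + \sum_(k0 <= j < N) gap u v j x)))%:E =
  (expR (a * c))%:E * (\prod_(i <- s0) L (- a) i.2 * \prod_(k0 <= j < N) (L a j * L (- a) j)).
Proof.
move=> uv us0 hu hv.
pose rows w := [seq (w, j) : I | j <- index_iota k0 N].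
pose s := s0 ++ rows u ++ rows v.
pose coef (i : I) : R := if i.1 == u then a else (- a)%R.
have urows w : uniq (rows w) by rewrite map_inj_uniq ?iota_uniq// => j1 j2 [].
have us : uniq s.
  rewrite /s !cat_uniq us0 !urows /= andbT has_cat negb_or -!all_predC; apply/andP; split.
    apply/andP; split; apply/allP => i /mapP[j]; rewrite mem_index_iota => /andP[kj _] -> /=.
      by apply/negP => /hu; rewrite eqxx.
    exact: hv.
  by apply/allP => i /mapP[j _ ->] /=; apply/negP => /mapP[j' _ [E]]; move: uv; rewrite E eqxx.
transitivity (\int[mu]_x ((expR (a * c))%:E * (expR (\sum_(i <- s) coef i * x i))%:E)).
  apply: eq_integral => x _; rewrite -EFinM -expRD; congr ((expR _)%:E).
  rewrite /s !big_cat/= !big_map /= mulrDr mulrBr -!addrA; congr (_ + _)%R.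
  congr (_ + _)%R.
    rewrite mulr_sumr -sumrN big_seq [RHS]big_seq; apply: eq_bigr => i /hu /negbTE iu.
    by rewrite /coef iu mulNr.
  rewrite mulr_sumr -big_split/=; apply: eq_bigr => j _.
  by rewrite /coef/= eqxx eq_sym (negbTE uv) /gap; ring.
have mS : measurable_fun setT (fun x : config R I => \sum_(i <- s) coef i * x i)%R.
  by apply: measurable_sum => i; apply: measurable_funM => //; exact: measurable_coord.
rewrite ge0_integralZl//; last by apply/measurable_EFinP; exact: measurableT_comp.
congr (_ * _); rewrite (integral_expR_sum _ hmu us) /s !big_cat/= !big_map; congr (_ * _).
  rewrite big_seq [RHS]big_seq; apply: eq_bigr => i /hu /negbTE iu.
  by rewrite /coef iu.
rewrite -big_split/=; apply: eq_bigr => j _.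
by rewrite /coef/= eqxx eq_sym (negbTE uv).
Qed.

(** The product is the expectation of [exp (a * (X - X'))] for independent copies; averaging over
    the exchange of the two rows replaces the exponential by a hyperbolic cosine. It follows that
    the partial products in the hypothesis are nondecreasing. *)
Lemma laplace_pair_ge1 (a : R) j : 1 <= L a j * L (- a) j.
Proof.
have uv : [::] != [:: 0%N] by [].
have := @integral_rows a 0%R _ _ [::] j j.+1 uv isT (fun i => ltac:(done)) (fun i _ => isT).
rewrite big_nil big_nat1 mulr0 expR0 !mul1e => <-.
set F := fun x : config R I => _.
have mF : measurable_fun setT F.
  apply/measurable_EFinP; apply: measurableT_comp => //; apply: measurable_funM => //.
  apply: measurable_funD => //.
    by apply: measurable_funB => //; apply: measurable_sum => i; exact: measurable_coord.
  by apply: measurable_sum => i; exact: measurable_gap.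
have F0 x : 0 <= F x by rewrite lee_fin expR_ge0.
have E := @integral_phi _ _ _ mu (phi [::] [:: 0%N])
  (fun b => measurable_relabel _) (phi_inv hmu uv) predT F mF F0.
have half0 : 0 <= (2^-1)%:E :> \bar R by rewrite lee_fin invr_ge0.
have mFp : measurable_fun setT (F \o phi [::] [:: 0%N] predT).
  by apply: measurableT_comp => //; exact: measurable_relabel.
have -> : \int[mu]_x F x = \int[mu]_x ((2^-1)%:E * F x + (2^-1)%:E * F (phi [::] [:: 0%N] predT x)).
  rewrite ge0_integralD//; last 4 first.
  - by move=> x _; exact: mule_ge0.
  - exact: measurable_funeM.
  - by move=> x _; exact: mule_ge0.
  - exact: measurable_funeM.
  rewrite !ge0_integralZl// E -ge0_muleDl// -EFinD.
  by rewrite (_ : 2^-1 + 2^-1 = 1)%R ?mul1e//; field.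
rewrite (_ : 1 = \int[mu]_x (cst 1) x); last first.
  by rewrite integral_cst// mul1e; exact/esym/probability_setT.
apply: ge0_le_integral => //.
- apply: emeasurable_funD; exact: measurable_funeM.
- move=> x _; rewrite /F !big_nat1 !big_nil gap_phi//= -!EFinM -EFinD lee_fin.
  set t := (a * _)%R; set t' := (a * _)%R.
  have -> : t' = (- t)%R by rewrite /t /t'; ring.
  have := expR_ge1Dx t; have := expR_ge1Dx (- t)%R; lra.
Qed.

(** All factors are at least 1, so every block of the product starting at [K] or later is bounded by
    the limit. *)
Lemma laplace_prod_bound (a : R) K (l : \bar R) :
  (fun n => \prod_(K <= i < n) (L a i * L (- a) i)) @ \oo --> l -> l < +oo ->
  exists2 C : R, (0 <= C)%R &
    forall k N, (K <= k)%N -> \prod_(k <= i < N) (L a i * L (- a) i) <= C%:E.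
Proof.
move=> cl loo; pose f i := L a i * L (- a) i.
have f1 i : 1 <= f i by exact: laplace_pair_ge1.
have f0 i : 0 <= f i by apply: le_trans (f1 i).
have P1 m n : 1 <= \prod_(m <= i < n) f i.
  apply: (big_ind (fun y => 1 <= y)) => // y z y1 z1.
  by rewrite -[leLHS]mule1; apply: lee_pmul.
have nd : nondecreasing_seq (fun n => \prod_(K <= i < n) f i).
  apply/nondecreasing_seqP => n; have [Kn|nK] := leqP K n.
    rewrite big_nat_recr//= -[leLHS]mule1; apply: lee_pmul => //.
    by apply: le_trans (P1 K n).
  by rewrite !big_geq// ltnW.
have lE n : \prod_(K <= i < n) f i <= l.
  rewrite -(cvg_lim _ cl)//; apply: lime_ge; first by apply/cvg_ex; exists l.
  by exists n => // k /= nk; exact: nd.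
have l1 : 1 <= l by apply: le_trans (lE 0%N).
have lf : l = (fine l)%:E by rewrite fineK// ge0_fin_numE// (le_trans _ l1).
exists (fine l); first by apply: fine_ge0; apply: le_trans l1.
move=> k N Kk; rewrite -lf.
have [kN|Nk] := leqP k N; last by rewrite big_geq// ltnW.
apply: le_trans (lE N); rewrite [leRHS](big_cat_nat _ (n := k))//= -[leLHS]mul1e.
by apply: lee_pmul => //; apply: le_trans (P1 _ _).
Qed.

Variables (a C : R) (K : nat).
Hypothesis a0 : (0 < a)%R.
Hypothesis C0 : (0 <= C)%R.
Hypothesis hprod : forall k N, (K <= k)%N -> \prod_(k <= i < N) (L a i * L (- a) i) <= C%:E.
Hypothesis hsum : \sum_(0 <= j <oo) \prod_(i < j.+1) L (- a) i < 1.

Lemma sum_gap u v k N (x : config R I) : (k <= N)%N ->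
  (\sum_(k <= j < N) gap u v j x = psum (gap u v) N x - psum (gap u v) k x)%R.
Proof.
move=> kN; rewrite /psum -!(big_mkord xpredT (fun j => gap u v j x)).
by rewrite [X in (_ = X - _)%R](big_cat_nat _ (n := k))//=; ring.
Qed.

(** The walk restarted at time [K] exceeds the level [c] with probability at most
    [2 * C * exp (- a * c)], which tends to zero. The first [K] increments are subtracted through
    [Y]. *)
Lemma gap_bounded_above u v : u != v ->
  {ae mu, forall x, exists c : R, forall k, (psum (gap u v) k x <= c)%R}.
Proof.
move=> uv.
pose Y (c : nat) (x : config R I) := (- c%:R - psum (gap u v) K x)%R.
have mS n := measurable_psum (measurable_gap (R := R) u v) n.
have mY c : measurable_fun setT (Y c) by apply: measurable_funB.
pose A c := [set x | exists n, (K <= n)%N /\ (0 < Y c x + psum (gap u v) n x)%R].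
have mA c : measurable (A c).
  by rewrite /A; mevent => //; apply: measurable_funD => //; exact: mS.
have hA c : mu (A c) <= 2%:E * (expR (- a * c%:R) * C)%:E.
  apply: (@expR_maximal_inequality _ _ _ mu (gap u v) (phi u v) (measurable_gap u v)
    (fun b => measurable_relabel (flip u v b)) (phi_inv hmu uv) (gap_phi uv) (Y c) K a) => //.
    move=> b x hb; rewrite /Y /psum; congr (_ - _)%R; apply: eq_bigr => j _.
    by rewrite gap_phi//; case: ifP => // /hb; rewrite leqNgt ltn_ord.
  move=> N KN; rewrite EFinM.
  have := @integral_rows a (- c%:R)%R u v [::] K N uv isT (fun i => ltac:(done)) (fun i _ => isT).
  rewrite big_nil mul1e mulrN -mulNr => E.
  rewrite (_ : \int[mu]_x _ = (expR (- a * c%:R))%:E * \prod_(K <= j < N) (L a j * L (- a) j)).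
    by rewrite lee_pmul2l ?lte_fin ?expR_gt0// hprod.
  rewrite -E; apply: eq_integral => x _; rewrite big_nil sum_gap// /Y.
  by congr ((expR _)%:E); ring.
pose B := [set x | forall c, A c x].
have mB : measurable B by exact: measurable_forall.
have B0 : mu B = 0.
  apply/eqP; rewrite eq_le measure_ge0 andbT.
  have hc : (2 * (expR (- a) ^+ c * C))%R%:E @[c --> \oo] --> (2 * (0 * C))%R%:E.
    apply: cvg_EFin; first exact: nearW.
    apply: cvgM; first exact: cvg_cst.
    apply: cvgM; last exact: cvg_cst.
    apply: cvg_expr; rewrite ger0_norm ?expR_ge0//.
    by rewrite -expR0 ltr_expR oppr_lt0.
  rewrite mul0r mulr0 in hc; rewrite -[leRHS](cvg_lim _ hc)//; apply: lime_ge.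
    by apply/cvg_ex; eexists; exact: hc.
  apply: nearW => c.
  rewrite (_ : (2 * _)%R%:E = 2%:E * (expR (- a * c%:R) * C)%:E); last first.
    by rewrite -EFinM -expRM_natl [(c%:R * _)%R]mulrC.
  apply: le_trans (hA c); apply: le_measure; rewrite ?inE// => x; exact.
have := null_ae mB B0; apply: filterS => x /existsNP[c hc].
apply: (@eventually_le_bounded _ _ K (c%:R + psum (gap u v) K x)) => n Kn.
rewrite leNgt; apply/negP => h; apply: hc; exists n; split=> //.
by rewrite /Y; lra.
Qed.

Lemma rbirth_flip u v (b : pred nat) (x : config R I) w :
  (forall i, i \in path_idx [::] w -> ~~ b i.2) -> rbirth (phi u v b x) w = rbirth x w.
Proof.
move=> hb; rewrite /rbirth big_seq [RHS]big_seq; apply: eq_bigr => i /hb /negbTE bi.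
by rewrite /phi /relabel /flip bi.
Qed.

Lemma pairwise_order u v : u != v -> {ae mu, forall x,
  (exists N, forall n, (N <= n)%N -> (rbirth x (rcons u n) <= rbirth x (rcons v n))%R) \/
  (exists N, forall n, (N <= n)%N -> (rbirth x (rcons v n) <= rbirth x (rcons u n))%R)}.
Proof.
move=> uv.
(* If one of the nodes is an ancestor of the other, its row occurs in the other's birth time. Flips
   in columns from [m0] on leave both birth times unchanged. *)
pose m0 := (\max_(i <- path_idx [::] u ++ path_idx [::] v) i.2).+1.
have hm0 w (i : I) : i \in path_idx [::] w ->
    {subset path_idx [::] w <= path_idx [::] u ++ path_idx [::] v} -> (i.2 < m0)%N.
  by move=> iw sub; rewrite ltnS; exact: (leq_bigmax_seq (F := snd) i (sub i iw) isT).
pose Y (x : config R I) : R := (rbirth x u - rbirth x v)%R.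
have mY : measurable_fun setT (Y : config R I -> R).
  by apply: measurable_funB; exact: measurable_rbirth.
have hY i x : (m0 <= i)%N -> Y (phi u v (pred1 i) x) = Y x.
  move=> mi; rewrite /Y !rbirth_flip//.
    move=> k kv; rewrite /= neq_ltn (leq_trans _ mi)//; apply: (hm0 v k kv).
    by move=> y yv; rewrite mem_cat yv orbT.
  move=> k ku; rewrite /= neq_ltn (leq_trans _ mi)//; apply: (hm0 u k ku).
  by move=> y yu; rewrite mem_cat yu.
have h1 := bounded_above_cvg (measurable_gap u v) (fun a => measurable_relabel (flip u v a))
    (phi_inv hmu uv) (gap_phi uv).
have h2 := no_crossing (measurable_gap u v) (fun a => measurable_relabel (flip u v a))
    (phi_inv hmu uv) (gap_phi uv) mY hY.
apply: filterS3 h1 h2 (gap_bounded_above uv) => x hc hx hb.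
(* The child with index [n] is born after [n.+1] waiting times, hence the shift. *)
have E n : (Y x + psum (gap u v) n.+1 x = rbirth x (rcons u n) - rbirth x (rcons v n))%R.
  by rewrite /Y /psum !rbirth_rcons sumrB; ring.
case: (hx (hc hb)) => -[N hN]; [left|right]; exists N => n Nn;
  by have := hN n.+1 (leqW Nn); rewrite E; lra.
Qed.

(** With this choice [weight e w] is the expectation of [expR (- a * rbirth x w)]. *)
Let e i : R := (\prod_(j < i.+1) fine (L (- a) j))%R.

Let e_ge0 i : (0 <= e i)%R.
Proof. by apply: prodr_ge0 => j _; apply: fine_ge0; exact: laplace_ge0. Qed.

Let eE i : (e i)%:E = \prod_(j < i.+1) L (- a) j.
Proof. by rewrite EFin_prod; apply: eq_bigr => j _; rewrite -laplace_fin// ltW. Qed.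

Lemma measurable_nonneg : measurable [set x : config R I | forall k, (0 <= x k)%R].
Proof.
rewrite (_ : [set x | _] = [set x : config R I |
    forall n : nat, if unpickle n is Some k then (0 <= x k)%R : Prop else True]).
  apply: measurable_forall => n; case: (unpickle n) => [k|]; last exact: measurable_const.
  by apply: measurable_le => //; exact: measurable_coord.
apply/seteqP; split=> x h; first by move=> n; case: (unpickle n).
by move=> k; have := h (pickle k); rewrite pickleK.
Qed.

(** The cut-off [c] controls the first [K] waiting times of the root, whose positive exponential
    moments may be infinite. Nonnegativity is part of the event because the comparison of partial
    sums in the bound below relies on it pointwise. *)
Lemma measurable_overtake i w (c : R) :
  measurable [set x : config R I | (forall k, 0 <= x k)%R /\
    ((\sum_(j < K) x ([::], j : nat) <= c)%R /\
    exists n, (i < n)%N /\ (rbirth x (rcons (i :: w) n) < rbirth x [:: n])%R)].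
Proof.
apply: measurable_conj; first exact: measurable_nonneg.
mevent => //; try exact: measurable_rbirth.
by apply: measurable_sum => j; exact: measurable_coord.
Qed.

(* Node [i :: w] can only overtake the root after the root has child [i], so the
   first [i.+1] waiting times of the root cancel against its birth time. *)
Lemma overtake_bound i w (c : R) :
  mu [set x | (forall k, 0 <= x k)%R /\ ((\sum_(j < K) x ([::], j : nat) <= c)%R /\
    exists n, (i < n)%N /\ (rbirth x (rcons (i :: w) n) < rbirth x [:: n])%R)] <=
  (2 * expR (a * c) * C * weight e (i :: w))%:E.
Proof.
set u := i :: w; set r : seq nat := [::].
have ru : r != u by [].
pose k0 := maxn K i.+1.
(* The cancellation would lose the factor of the letter [i]. The first [i.+1] waiting times of [u]
   itself, which have the same law as those of the root, restore it: the sum over [s0] has the law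
   of the birth time of [u]. *)
pose s0 : seq I := [seq (u, j) | j <- iota 0 i.+1] ++ path_idx [:: i] w.
have sz k : k \in path_idx [:: i] w -> (k.1 != r) && (k.1 != u).
  move=> /path_idx_size /=; rewrite -size_eq0 => /andP[h1 h2].
  by rewrite -lt0n h1/=; apply/eqP => E; move: h2; rewrite E /u/= ltnn.
pose Y (x : config R I) : R := (c - \sum_(k <- s0) x k - psum (gap r u) k0 x)%R.
have mS n := measurable_psum (measurable_gap (R := R) r u) n.
have mY : measurable_fun setT (Y : config R I -> R).
  apply: measurable_funB => //; apply: measurable_funB => //.
  by apply: measurable_sum => k; exact: measurable_coord.
have hY (b : pred nat) x : (forall j, b j -> (k0 <= j)%N) -> Y (phi r u b x) = Y x.
  move=> hb; rewrite /Y; congr (_ - _ - _)%R.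
    rewrite big_seq [RHS]big_seq; apply: eq_bigr => k.
    rewrite /phi /relabel /flip mem_cat => /orP[/mapP[j]|/sz/andP[/negbTE -> /negbTE ->]].
      rewrite mem_iota add0n ltnS => /andP[_ ji] -> /=; case: ifP => // /hb.
      by rewrite leqNgt /k0 leq_max ltnS ji orbT.
    by case: ifP => //; case: k.
  rewrite /psum; apply: eq_bigr => j _.
  by rewrite gap_phi//; case: ifP => // /hb; rewrite leqNgt ltn_ord.
have us0 : uniq s0.
  rewrite cat_uniq path_idx_uniq andbT map_inj_uniq; last by move=> j1 j2 [].
  rewrite iota_uniq andTb; apply/hasPn => k /sz/andP[_ ku].
  by apply/negP => /mapP[j _ E]; move: ku; rewrite E eqxx.
have hint N : (k0 <= N)%N ->
    \int[mu]_x (expR (a * (Y x + psum (gap r u) N x)))%:E <= (expR (a * c) * C * weight e u)%:E.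
  move=> kN.
  have h1 k : k \in s0 -> k.1 != r.
    by rewrite mem_cat => /orP[/mapP[j _ ->] //|/sz/andP[]].
  have h2 j : (k0 <= j)%N -> (u, j) \notin s0.
    rewrite geq_max => /andP[_ ij]; rewrite mem_cat negb_or; apply/andP; split.
      apply/negP => /mapP[j']; rewrite mem_iota add0n => /andP[_ ji] [E].
      by move: ij; rewrite E leqNgt ji.
    by apply/negP => /sz/andP[_]; rewrite eqxx.
  have E := @integral_rows a c r u s0 k0 N ru us0 h1 h2.
  rewrite (_ : \int[mu]_x _ = (expR (a * c))%:E *
    (\prod_(k <- s0) L (- a) k.2 * \prod_(k0 <= j < N) (L a j * L (- a) j))).
    have -> : \prod_(k <- s0) L (- a) k.2 = (weight e u)%:E.
      rewrite /weight EFin_prod /s0 big_cat /u [RHS]big_cons eE; congr (_ * _).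
        by rewrite -(big_mkord xpredT (L (- a))) /index_iota subn0 big_map.
      rewrite prod_path_idx; apply: eq_bigr => k _; exact/esym/eE.
    rewrite -mulrA EFinM lee_pmul2l ?lte_fin ?expR_gt0// mulrC EFinM.
    apply: lee_wpmul2l; first by rewrite lee_fin; apply: weight_ge0.
    by apply: hprod; rewrite leq_maxl.
  rewrite -E; apply: eq_integral => x _; rewrite sum_gap// /Y.
  by congr ((expR _)%:E); ring.
have := expR_maximal_inequality (measurable_gap r u) (fun b => measurable_relabel (flip r u b))
    (phi_inv hmu ru) (gap_phi ru) a0 mY hY hint.
rewrite -EFinM !mulrA; apply: le_trans; apply: le_measure; rewrite ?inE.
- exact: measurable_overtake.
- by mevent => //; apply: measurable_funD => //; exact: mS.
move=> x [x0 [hc [n [ni hn]]]].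
pose A k := (\sum_(j < k) x (r, j : nat))%R.
pose B k := (\sum_(j < k) x (u, j : nat))%R.
have mono (f : nat -> R) k k' : (forall j, 0 <= f j)%R -> (k <= k')%N ->
    (\sum_(j < k) f j <= \sum_(j < k') f j)%R.
  move=> f0 kk'; rewrite -!(big_mkord xpredT f) [leRHS](big_cat_nat _ (n := k))//= lerDl.
  by rewrite sumr_ge0.
have mA k k' : (k <= k')%N -> (A k <= A k')%R by exact: (mono (fun j => x (r, j))).
have mB k k' : (k <= k')%N -> (B k <= B k')%R by exact: (mono (fun j => x (u, j))).
have A0 k : (0 <= A k)%R by rewrite sumr_ge0.
have SE k : psum (gap r u) k x = (A k - B k)%R by rewrite /psum sumrB.
pose beta := (\sum_(k <- path_idx [:: i] w) x k)%R.
have s0E : (\sum_(k <- s0) x k = B i.+1 + beta)%R.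
  rewrite /s0 big_cat; congr (_ + _)%R.
  by rewrite /B -(big_mkord xpredT (fun j => x (u, j))) /index_iota subn0 big_map.
have bu : rbirth x u = (A i.+1 + beta)%R.
  rewrite /rbirth /u path_idx_cons big_cat; congr (_ + _)%R.
  by rewrite /A -(big_mkord xpredT (fun j => x (r, j))) /index_iota subn0 big_map.
have hn' : (A i.+1 + beta + B n.+1 < A n.+1)%R.
  move: hn; rewrite -/u rbirth_rcons bu -[[:: n]]/(rcons [::] n) rbirth_rcons.
  by rewrite rbirth_nil add0r.
have beta0 : (0 <= beta)%R by rewrite sumr_ge0.
have hAK : (A K <= c)%R := hc.
(* If [n.+1] is smaller than [k0], then [k0 = K], and the cut-off alone makes the walk positive at
   its starting time [k0]. *)
exists (maxn n.+1 k0); split; first exact: leq_maxr.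
rewrite /Y s0E !SE; have [kn|nk] := leqP k0 n.+1.
  have h1 : (A k0 - A i.+1 <= c)%R.
    by rewrite /k0 /maxn; case: ifP => _; have := A0 i.+1; have := A0 K; lra.
  have h2 := mB i.+1 k0 (leq_maxr _ _); lra.
have k0K : k0 = K by move: nk; rewrite /k0; lia.
have h1 := mB i.+1 n.+1 (ltnW ni).
have h2 : (A n.+1 <= A K)%R by apply: mA; rewrite -k0K ltnW.
have := A0 i.+1; lra.
Qed.

Lemma hub_ae :
  {ae mu, forall x, has_persistent_hub (R := R) (cmj_seq (fun u j => (x (u, j))%:E))}.
Proof.
pose m := fine (\sum_(0 <= j <oo) \prod_(i < j.+1) L (- a) i).
have t0 i : 0 <= \prod_(j < i.+1) L (- a) j by apply: prode_ge0 => j _; exact: laplace_ge0.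
have s0 : 0 <= \sum_(0 <= j <oo) \prod_(i < j.+1) L (- a) i.
  by apply: nneseries_ge0 => j _ _.
have mE : \sum_(0 <= j <oo) \prod_(i < j.+1) L (- a) i = m%:E.
  by rewrite /m fineK// ge0_fin_numE// (lt_trans hsum)// ltry.
have m1 : (m < 1)%R by rewrite -lte_fin -mE.
have se N : (\sum_(i < N) e i <= m)%R.
  rewrite -lee_fin -mE -sumEFin; under eq_bigr do rewrite eE.
  rewrite -(big_mkord xpredT (fun i => \prod_(j < i.+1) L (- a) j)).
  exact: nneseries_lim_ge.
have h1 := @locally_finite _ _ _ hmu a m e xpredT a0 e_ge0 m1 se (fun i _ => ltac:(by rewrite eE)).
have h2 : {ae mu, forall x (p : seq nat * seq nat), p.1 != p.2 ->
  (exists N, forall n, (N <= n)%N -> (rbirth x (rcons p.1 n) <= rbirth x (rcons p.2 n))%R) \/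
  (exists N, forall n, (N <= n)%N -> (rbirth x (rcons p.2 n) <= rbirth x (rcons p.1 n))%R)}.
  apply: ae_forall_count => -[u v] /=; have [uv|uv] := boolP (u != v); last first.
    by apply: aeW => x.
  by have := pairwise_order uv; apply: filterS => x hx _.
pose Ev (c : nat) (w : seq nat) : set (config R I) :=
  if w is i :: w' then
    [set x | (forall k, 0 <= x k)%R /\ ((\sum_(j < K) x ([::], j : nat) <= c%:R)%R /\
      exists n, (i < n)%N /\ (rbirth x (rcons (i :: w') n) < rbirth x [:: n])%R)]
  else set0.
have mEv c w : measurable (Ev c w).
  by case: w => [|i w]; [exact: measurable0|exact: (measurable_overtake i w c%:R)].
have h3 : {ae mu, forall x (c : nat), finite_set [set w | Ev c w x]}.
  apply: ae_foralln => c.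
  apply: (borel_cantelli_words e_ge0 m1 se (C := (2 * expR (a * c%:R) * C)%R)) (mEv c) _.
    by rewrite !mulr_ge0 ?expR_ge0.
  move=> [|i w]; last exact: overtake_bound.
  by rewrite measure0 lee_fin mulr_ge0 ?weight_ge0// !mulr_ge0 ?expR_ge0.
have := ae_nonneg nu_pos hmu.
apply: filterS2 (filterI h1 (filterI h2 h3)) => x [hf [hp hE]] x0.
(* The level may depend on the configuration, since the finiteness holds simultaneously for all
   natural levels. *)
pose c := Num.bound (\sum_(j < K) x ([::], j : nat))%R.
have /finite_seqP[s hs] := hE c.
apply: (hub_exists x0 (s := s)).
- by move=> t; apply: sub_finite_set (hf t) => w wt; split=> //; rewrite all_predT.
- move=> i w n nis ni; rewrite leNgt; apply/negP => hn.
  suff : Ev c (i :: w) x.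
    move=> hEv; move: nis => /negP; apply.
    by rewrite -[is_true _]/([set` s] (i :: w)) -hs.
  split=> //; split; last by exists n.
  exact: ltW (unstable.ltr_bound _).
- by move=> u v uv; exact: (hp (u, v) uv).
Qed.

End Persistence.

(** * Laws of families of random sequences *)

Definition mfun_of d d' (T : measurableType d) (T' : measurableType d') (f : T -> T')
    (mf : measurable_fun setT f) : {mfun T >-> T'} :=
  HB.pack f (isMeasurableFun.Build _ _ _ _ f mf).

Lemma ae_distribution d d' (T : measurableType d) (T' : measurableType d') (R : realType)
    (P : probability T R) (X : {mfun T >-> T'}) (Q : T' -> Prop) :
  {ae distribution P X, forall y, Q y} -> {ae P, forall w, Q (X w)}.
Proof.
move=> [N [mN N0 hN]]; exists (X @^-1` N); split=> //.
  by rewrite -[X in measurable X]setTI; exact: measurable_funP.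
by move=> w /= h; apply: hN.
Qed.

Lemma measurable_expeR (R : realType) : measurable_fun setT (@expeR R).
Proof.
rewrite (_ : @expeR R = fun y => if y == +oo then +oo else
    if y == -oo then 0 else (expR (fine y))%:E); last first.
  by apply/funext => -[r| |].
have meq (z : \bar R) : measurable_fun setT (fun y : \bar R => y == z).
  apply: (@measurable_fun_bool _ _ _ _ true); rewrite setTI.
  rewrite (_ : _ @^-1` _ = [set z]); first exact: emeasurable_set1.
  by apply/seteqP; split=> y /= /eqP.
apply: measurable_fun_ifT => //; apply: measurable_fun_ifT => //.
by apply/measurable_EFinP; apply: measurableT_comp.
Qed.

Section Families.
Context {R : realType} {d : measure_display} {Omega : measurableType d}.
Variable P : probability Omega R.
Variable Xg : nat -> Omega -> \bar R.
Hypothesis mXg : forall j, measurable_fun setT (Xg j).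
Hypothesis indXg : mutual_indep P Xg.

Section Family.
Variables (I : countType) (Y : I -> nat -> Omega -> \bar R).
Hypothesis mY : forall i j, measurable_fun setT (Y i j).
Hypothesis lawY : forall i, same_law P (Y i) Xg.
Hypothesis indY : indep_seqs P Y.

(** Independence across sequences is stated with a common length [n], so [s] is enlarged to a
    rectangle carrying the trivial constraint [setT] outside [s]. *)
Lemma family_product_rule (s : seq (I * nat)) (B : I * nat -> set (\bar R)) :
  uniq s -> (forall k, measurable (B k)) ->
  P [set w | forall k, k \in s -> B k (Y k.1 k.2 w)] =
  \prod_(k <- s) P (Xg k.2 @^-1` B k).
Proof.
move=> us mB.
pose is_ := undup [seq k.1 | k <- s].
have [n hn] : exists n, forall k, k \in s -> (k.2 < n)%N.
  exists (\max_(k <- s) k.2).+1 => k ks; rewrite ltnS.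
  exact: (leq_bigmax_seq (F := snd) k ks isT).
pose B' i j := if (i, j) \in s then B (i, j) else setT.
have mB' i j : measurable (B' i j) by rewrite /B'; case: ifP.
have hs k : k \in s -> (k.1 \in is_) && (k.2 < n)%N.
  by move=> ks; rewrite mem_undup map_f//= hn.
transitivity (P (\bigcap_(i in [set i | i \in is_])
    \bigcap_(j in [set j | (j < n)%N]) (Y i j @^-1` B' i j))).
  congr (P _); apply/seteqP; split=> w h.
    by move=> i _ j _; rewrite /B' /=; case: ifP => // /h.
  move=> [i j] ks; have /andP[hi hj] := hs _ ks.
  by have := h i hi j hj; rewrite /B' /= ks.
rewrite (indY (undup_uniq _) _ mB').
transitivity (\prod_(i <- is_) \prod_(j <- iota 0 n) P (Xg j @^-1` B' i j)).
  apply: eq_bigr => i _; rewrite (lawY i)//.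
  have iotaE m : [set j | (j < m)%N] = [set j | j \in iota 0 m].
    by apply/seteqP; split=> j /=; rewrite mem_iota add0n.
  rewrite iotaE; exact: (indXg (iota_uniq 0 n)).
rewrite -(big_allpairs (r1 := is_) (r2 := iota 0 n)
  (F := fun k => P (Xg k.2 @^-1` B' k.1 k.2))).
rewrite (bigID (mem s))/= [X in _ * X]big1 ?mule1; last first.
  by move=> [i j] /= /negbTE h; rewrite /B' h; exact: probability_setT.
rewrite -big_filter (perm_big s).
  rewrite big_seq [RHS]big_seq; apply: eq_bigr => -[i j] /= ks.
  by rewrite /B' ks.
apply: uniq_perm => //.
  apply: filter_uniq; apply: allpairs_uniq; [exact: undup_uniq|exact: iota_uniq|].
  by move=> [? ?] [? ?] _ _.
move=> [i j]; rewrite mem_filter/=; case: (boolP ((i, j) \in s)) => //= ks.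
have /andP[hi hj] := hs _ ks.
by apply/allpairsP; exists (i, j); split=> //=; rewrite mem_iota.
Qed.

(** The default value of [fine] at [+oo] is harmless, because infinite waiting times form a null
    event. *)
Definition family_config (w : Omega) : config R (I * nat)%type :=
  fun k => fine (Y k.1 k.2 w).

Lemma measurable_family_config : measurable_fun setT family_config.
Proof.
apply: measurable_to_config => k.
exact: (measurableT_comp (@fine_measurable R _ measurableT) (mY k.1 k.2)).
Qed.

Lemma measurable_fine_Xg j : measurable_fun setT (fun w => fine (Xg j w)).
Proof. exact: (measurableT_comp (@fine_measurable R _ measurableT) (mXg j)). Qed.

Lemma family_product_law : product_law snd
  (fun j => distribution P (mfun_of (measurable_fine_Xg j)))
  (distribution P (mfun_of measurable_family_config)).
Proof.
move=> s B us mB.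
pose B' k : set (\bar R) := fine @^-1` B k.
have mB' k : measurable (B' k).
  by rewrite /B' -[X in measurable X]setTI; exact: fine_measurable.
exact: (family_product_rule us mB').
Qed.

Lemma ae_family_finite : (forall i j w, 0 <= Y i j w) ->
  (forall j, P [set w | Xg j w = +oo] = 0) ->
  {ae P, forall w i j, Y i j w = (family_config w (i, j))%:E}.
Proof.
move=> Y0 Xfin.
have : {ae P, forall w (k : I * nat), Y k.1 k.2 w <> +oo}.
  apply: ae_forall_count => k.
  have my : measurable [set +oo : \bar R] by exact: emeasurable_set1.
  have mk : measurable [set w | Y k.1 k.2 w = +oo].
    by have := mY k.1 k.2 measurableT my; rewrite setTI.
  apply: (null_ae mk).
  have := @family_product_rule [:: k] (fun=> [set +oo]) isT (fun=> my).
  rewrite big_seq1 [X in _ = X]Xfin => <-; congr (P _); apply/seteqP; split=> w /= h.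
    by move=> k'; rewrite inE => /eqP ->.
  by apply: h; rewrite inE.
apply: filterS => w h i j; rewrite /family_config/= fineK// ge0_fin_numE//.
by have := h (i, j); rewrite /= => /eqP; rewrite -ltey.
Qed.

Lemma measurable_expR_config (s : seq (I * nat)) (a : I * nat -> R) :
  measurable_fun setT (fun w => (expR (\sum_(k <- s) a k * family_config w k))%:E).
Proof.
apply/measurable_EFinP; apply: measurableT_comp => //; apply: measurable_sum => k.
apply: measurable_funM => //.
exact: (measurableT_comp (@fine_measurable R _ measurableT) (mY k.1 k.2)).
Qed.

Lemma integral_family_expR (s : seq (I * nat)) (a : I * nat -> R) : uniq s ->
  \int[P]_w (expR (\sum_(k <- s) a k * family_config w k))%:E =
  \prod_(k <- s) laplace (fun j => distribution P (mfun_of (measurable_fine_Xg j))) (a k) k.2.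
Proof.
move=> us; rewrite -(integral_expR_sum a family_product_law us).
rewrite ge0_integral_distribution//.
apply/measurable_EFinP; apply: measurableT_comp => //; apply: measurable_sum => k.
by apply: measurable_funM => //; exact: measurable_coord.
Qed.

End Family.

End Families.

Theorem theorem2p4 (R : realType) (d : measure_display) (Omega : measurableType d)
  (P : probability Omega R)
  (Xg Xg' : nat -> Omega -> \bar R) (X : seq nat -> nat -> Omega -> \bar R) :
  (* random variables with values in [0, +oo] *)
  (forall j, measurable_fun setT (Xg j)) ->
  (forall j, measurable_fun setT (Xg' j)) ->
  (forall u j, measurable_fun setT (X u j)) ->
  (forall j w, 0 <= Xg j w) -> (forall j w, 0 <= Xg' j w) ->
  (forall u j w, 0 <= X u j w) ->
  (* each (X(uj))_j is a copy of (X_j)_j, independent over u *)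
  (forall u, same_law P (X u) Xg) -> indep_seqs P X ->
  (* (X'_j)_j is an independent copy of (X_j)_j *)
  same_law P Xg' Xg -> indep_seqs P (fun b : bool => if b then Xg else Xg') ->
  (* Assumption (A) *)
  mutual_indep P Xg ->
  (forall j, P [set w | Xg j w = +oo] = 0) ->
  \sum_(0 <= j <oo) (\prod_(i < j.+1) P [set w | Xg i w = 0]) < 1 ->
  (* 1. *)
  ({ae P, forall w, ~ cvgn (series (fun i => fine (Xg i w) - fine (Xg' i w))%R : nat -> R)} ->
   {ae P, forall w, ~ has_persistent_hub (R:=R) (cmj_seq (fun u j => X u j w))})
  /\
  (* 2. *)
  ((exists (a : R) (K : nat), (0 < a)%R /\ (1 <= K)%N /\
      \sum_(0 <= j <oo) (\int[P]_w expeR (- (a%:E * \sum_(i < j.+1) Xg i w))) < 1 /\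
      exists2 l : \bar R,
        (fun n => \prod_(K <= i < n) (\int[P]_w expeR (a%:E * (Xg' i w - Xg i w))))
          @ \oo --> l
        & l < +oo) ->
   {ae P, forall w, has_persistent_hub (R:=R) (cmj_seq (fun u j => X u j w))}).
Proof.
move=> mXg mXg' mX Xg0 Xg0' X0 lawX indX lawXg' indXg' indXg Xgfin hA.
(* The two generic sequences are treated as a family indexed by [bool], so that they obey the same
   product law as two rows of the tree. *)
pose Z (b : bool) : nat -> Omega -> \bar R := if b then Xg else Xg'.
have mZ b j : measurable_fun setT (Z b j) by case: b.
have Z0 b j w : 0 <= Z b j w by case: b.
have lawZ b : same_law P (Z b) Xg by case: b.
pose nu j : probability R R := distribution P (mfun_of (measurable_fine_Xg mXg j)).
pose mu : probability (config R (seq nat * nat)%type) R :=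
  distribution P (mfun_of (measurable_family_config mX)).
pose muZ : probability (config R (bool * nat)%type) R :=
  distribution P (mfun_of (measurable_family_config mZ)).
have hmu : product_law snd nu mu by exact: family_product_law.
have hmuZ : product_law snd nu muZ by exact: family_product_law.
have nu_pos j : nu j [set r | (r < 0)%R] = 0.
  have E : (fun w => fine (Xg j w)) @^-1` [set r | (r < 0)%R] = set0.
    apply/seteqP; split=> // w /=; rewrite ltNge => /negP; apply.
    exact: fine_ge0.
  by rewrite -[RHS](measure0 P) -E.
(* [fine] sends both 0 and [+oo] to 0, so the atom of [nu j] at zero also contains the null event of
   an infinite waiting time. *)
have nu0 j : nu j [set 0%R] = P [set w | Xg j w = 0].
  have m0 y : measurable [set w | Xg j w = y].
    by have := mXg j measurableT _ (emeasurable_set1 y); rewrite setTI.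
  rewrite -(measureU0 (m0 0) (m0 +oo) (Xgfin j)).
  congr (P _); apply/seteqP; split=> w /=.
    by have := Xg0 j w; case: (Xg j w) => [r _ /= ->|_ _|//]; [left|right].
  by move=> [|] ->.
have fX := ae_family_finite indXg mX lawX indX X0 Xgfin.
have fZ := ae_family_finite indXg mZ lawZ indXg' Z0 Xgfin.
split.
  move=> hdiv.
  have hA' : \sum_(0 <= j <oo) \prod_(i < j.+1) nu i [set 0%R] < 1.
    by under eq_eseriesr do under eq_bigr do rewrite nu0.
  have hdiv' u v : u != v -> {ae mu, forall x, ~ cvgn (psum (gap u v) ^~ x)}.
    move=> uv.
    pose s n (z : config R (bool * nat)%type) : R :=
      (\sum_(j < n) (z (true, j : nat) - z (false, j : nat)))%R.
    have ms n : measurable_fun setT (s n).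
      by apply: measurable_sum => j; apply: measurable_funB; exact: measurable_coord.
    pose C := [set z | forall k : nat, exists N, forall n, (N <= n)%N ->
      (`|s n z - s N z| <= k.+1%:R^-1)%R].
    have mC : measurable C.
      by rewrite /C; mevent => //; apply: measurableT_comp => //; apply: measurable_funB; exact: ms.
    have C0 : muZ C = 0.
      suff : P (family_config Z @^-1` C) = 0 by [].
      apply: measure_negligible.
        by have := measurable_family_config mZ measurableT mC; rewrite setTI.
      apply: negligibleS hdiv => w /= hC; apply; apply/cvg_seqP => k.
      have [N hN] := hC k; exists N => n /hN.
      by rewrite /series/= !big_mkord.
    (* [f] places the two generic sequences in the rows [u] and [v]; equality of the product laws
       carries the null event of convergence over to the tree. *)
    pose f (k : bool * nat) : seq nat * nat := (if k.1 then u else v, k.2).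
    have finj : injective f.
      move=> [[] j] [[] j'] []//= E; last by rewrite E.
      - by rewrite E.
      - by move: uv; rewrite E eqxx.
      - by move: uv; rewrite E eqxx.
    have hf := product_law_relabel (f := f) finj (fun k => erefl) hmu.
    have hC : mu (relabel f @^-1` C) = 0.
      by rewrite -C0; exact: (product_law_unique hf hmuZ).
    have mfC : measurable (relabel f @^-1` C).
      by have := measurable_relabel f measurableT mC; rewrite setTI.
    have := null_ae mfC hC; apply: filterS => x nC /cvg_seqP hx; apply: nC => k.
    exact: hx.
  have := ae_distribution (no_hub nu_pos hmu hA' hdiv').
  apply: filterS2 fX => w fw; congr (~ has_persistent_hub (cmj_seq _)).
  by apply/funext => u; apply/funext => j; rewrite fw.
move=> [a [K [a0 [_ [hsum [l hl loo]]]]]].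
have hsum' : \sum_(0 <= j <oo) \prod_(i < j.+1) laplace nu (- a) i < 1.
  rewrite (_ : \sum_(0 <= j <oo) _ =
    \sum_(0 <= j <oo) (\int[P]_w expeR (- (a%:E * \sum_(i < j.+1) Xg i w))))//.
  apply: eq_eseriesr => j _.
  have us : uniq [seq (true, i) | i <- iota 0 j.+1].
    by rewrite map_inj_uniq ?iota_uniq// => ? ? [].
  have := integral_family_expR mXg indXg mZ lawZ indXg' (fun=> - a)%R us.
  rewrite big_map -/(index_iota 0 j.+1) big_mkord => <-.
  apply: ge0_ae_eq_integral => //.
  - exact: measurable_expR_config.
  - apply: measurableT_comp; first exact: measurable_expeR.
    apply: measurableT_comp => //; apply: measurable_funeM.
    by apply: emeasurable_sum => i; exact: mXg.
  - by move=> w _; exact: expeR_ge0.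
  apply: filterS fZ => w fw _.
  have fw' i : Xg i w = (family_config Z w (true, i))%:E by rewrite -fw.
  under [in RHS]eq_bigr do rewrite fw'.
  rewrite sumEFin -EFinM -EFinN.
  by rewrite big_map -/(index_iota 0 j.+1) big_mkord -mulr_sumr mulNr.
(* Off the null event of infinite waiting times the extended exponential is the real one;
   independence then splits the expectation, with [Xg'] contributing at [a] and [Xg] at [- a]. *)
have factor i : \int[P]_w expeR (a%:E * (Xg' i w - Xg i w)) = laplace nu a i * laplace nu (- a) i.
  have us : uniq [:: (false, i); (true, i)] by [].
  have := integral_family_expR mXg indXg mZ lawZ indXg'
    (fun k => if k.1 then (- a)%R else a) us.
  rewrite big_cons big_seq1/= => <-.
  apply: ge0_ae_eq_integral => //.
  - apply: measurableT_comp; first exact: measurable_expeR.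
    apply: measurable_funeM; exact: emeasurable_funB.
  - exact: measurable_expR_config.
  - by move=> w _; exact: expeR_ge0.
  apply: filterS fZ => w fw _.
  have -> : Xg i w = (family_config Z w (true, i))%:E by rewrite -fw.
  have -> : Xg' i w = (family_config Z w (false, i))%:E by rewrite -fw.
  rewrite -EFinB -EFinM/= big_cons big_seq1/=.
  by congr ((expR _)%:E); ring.
have [C C0 hC] : exists2 C : R, (0 <= C)%R & forall k N, (K <= k)%N ->
    \prod_(k <= i < N) (laplace nu a i * laplace nu (- a) i) <= C%:E.
  apply: (laplace_prod_bound hmu _ loo).
  by under eq_fun do under eq_bigr do rewrite -factor.
have := ae_distribution (hub_ae nu_pos hmu a0 C0 hC hsum').
apply: filterS2 fX => w fw; congr (has_persistent_hub (cmj_seq _)).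
by apply/funext => u; apply/funext => j; rewrite fw.
Qed.
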